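(* Let $d$ be the principal degree of $U_N$. For any random variable $W$, $$N^{d/2}(U_N-p^\emptyset)\xrightarrow[N\to\infty]{\mathcal D} W$$ if and only if $$N^{d/2}\sum_{\substack{(0,0)<(r,c)\le(p,q)\\ r+c=d}}P^{r,c}_N\xrightarrow[N\to\infty]{\mathcal D} W.$$
   Context: **Data.** $Y=(Y_{ij})_{i,j\ge1}$ is an infinite real random matrix that is row-column exchangeable (for all permutations $\sigma_1,\sigma_2$ of $\mathbb N$, $(Y_{\sigma_1(i)\sigma_2(j)})_{i,j}$ has the same distribution as $Y$) and dissociated (for all $(m,n)$, $(Y_{ij})_{i\le m,j\le n}$ is independent of $(Y_{ij})_{i>m,j>n}$). Fix an Aldous–Hoover–Kallenberg representation: $Y_{ij}=\phi(\xi_i,\eta_j,\zeta_{ij})$ a.s., with $\phi$ measurable and $(\xi_i)$, $(\eta_j)$, $(\zeta_{ij})$ mutually independent and uniform on $[0,1]$. **Kernel and $U$-statistic.** $[n]=\{1,\dots,n\}$; $\mathcal P_k(A)$ is the set of subsets of $A$ of cardinality $k$. Fix $p,q\ge1$ and a measurable $h:\mathcal M_{p,q}(\mathbb R)\to\mathbb R$ invariant under separate permutations of the rows and of the columns of its argument. For $\mathbf i\in\mathcal P_p(\mathbb N)$, $\mathbf j\in\mathcal P_q(\mathbb N)$, put $h_{\mathbf i,\mathbf j}=h(Y_{\mathbf i,\mathbf j})$, $h$ evaluated at the submatrix of $Y$ with rows $\mathbf i$ and columns $\mathbf j$; assume $\mathbb E[h_{\mathbf i,\mathbf j}^2]<\infty$.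 For $m\ge p$, $n\ge q$, $$U_{m,n}=\binom mp^{-1}\binom nq^{-1}\sum_{\mathbf i\in\mathcal P_p([m]),\,\mathbf j\in\mathcal P_q([n])}h_{\mathbf i,\mathbf j}.$$ **Graphs and projections.** A bipartite graph $G=(V_1(G),V_2(G),E(G))$ has finite row and column vertex sets $V_1(G),V_2(G)\subset\mathbb N$ (row and column vertices are different objects) and edges $E(G)\subseteq V_1(G)\times V_2(G)$; $v_1(G)=|V_1(G)|$, $v_2(G)=|V_2(G)|$; $\emptyset$ is the graph with no vertices. $F\subseteq G$ means $V_1(F)\subseteq V_1(G)$, $V_2(F)\subseteq V_2(G)$, $E(F)\subseteq(V_1(F)\times V_2(F))\cap E(G)$; $F\subset G$ means in addition $F\neq G$. $K_{\mathbf i,\mathbf j}=(\mathbf i,\mathbf j,\mathbf i\times\mathbf j)$ and $K_{p,q}=K_{[p],[q]}$. $H(G)=((\xi_i)_{i\in V_1(G)},(\eta_j)_{j\in V_2(G)},(\zeta_{ij})_{(i,j)\in E(G)})$. For $G\subseteq K_{\mathbf i,\mathbf j}$ define recursively $p^\emptyset(h_{\mathbf i,\mathbf j})=\mathbb E[h_{\mathbf i,\mathbf j}]$ and $p^G(h_{\mathbf i,\mathbf j})=\mathbb E[h_{\mathbf i,\mathbf j}\mid H(G)]-\sum_{F\subset G}p^F(h_{\mathbf i,\mathbf j})$. This does not depend on the choice of $(\mathbf i,\mathbf j)$ with $G\subseteq K_{\mathbf i,\mathbf j}$ and is written $p^G$. For $(0,0)\le(r,c)\le(p,q)$, $$P^{r,c}_{m,n}=\binom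 mp^{-1}\binom nq^{-1}\sum_{\mathbf i\in\mathcal P_p([m]),\,\mathbf j\in\mathcal P_q([n])}\ \sum_{\substack{G\subseteq K_{\mathbf i,\mathbf j}\\(v_1(G),v_2(G))=(r,c)}}p^G.$$ $(0,0)<(r,c)\le(p,q)$ means $0\le r\le p$, $0\le c\le q$, $(r,c)\ne(0,0)$. **Asymptotics.** $(m_N,n_N)$ is a sequence with $m_N+n_N=N$ and $m_N/N\to\rho\in(0,1)$; $U_N=U_{m_N,n_N}$, $P^{r,c}_N=P^{r,c}_{m_N,n_N}$ (for $N$ large enough that $m_N\ge p$, $n_N\ge q$). **Principal degree.** For $1\le k\le p+q$ let $p^{(k)}=\sum_{G\subseteq K_{p,q},\,v_1(G)+v_2(G)=k}p^G$. The principal degree $d$ is the smallest $k\ge1$ such that $p^{(k)}\ne0$ (as a random variable, i.e. not a.s. zero); it is assumed that such a $k$ exists. *)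

(* Defs.v *)
From HB Require Import structures.
From mathcomp Require Import all_boot all_order all_algebra perm finmap.
From mathcomp Require Import all_classical all_reals all_analysis.
From mathcomp Require Import measurable_realfun.
From mathcomp Require Import zify.

Set Implicit Arguments.
Unset Strict Implicit.
Unset Printing Implicit Defensive.

Import Order.TTheory GRing.Theory Num.Theory.
Import numFieldNormedType.Exports.

Local Open Scope fset_scope.
Local Open Scope classical_set_scope.
Local Open Scope ring_scope.

(* Smallest sigma-algebra on S making the maps X k, k \in D, measurable.  With
   D = setT and X the coordinate maps, it is the product sigma-algebra. *)
Definition sigma_gen (R : realType) (I S : Type) (D : set I)
    (X : I -> S -> R) : set_system S :=
  <<s \bigcup_(k in D) preimage_set_system setT (X k) measurable >>.

Section probability_notions.
Context {d : measure_display} {T : measurableType d} {R : realType}.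
Variable P : probability T R.

Definition same_law (I : Type) (X X' : I -> T -> R) : Prop :=
  forall A : set (I -> R), sigma_gen setT (fun k x => x k) A ->
    P [set w | A (X ^~ w)] = P [set w | A (X' ^~ w)].

Definition mutually_independent (I : choiceType) (X : I -> T -> R) : Prop :=
  forall (J : {fset I}) (B : I -> set R), (forall k, measurable (B k)) ->
    P (\bigcap_(k in [set` J]) (X k @^-1` B k)) =
    (\prod_(k <- J) P (X k @^-1` B k))%E.

Definition independent_systems (F F' : set_system T) : Prop :=
  forall A B, F A -> F' B -> P (A `&` B) = (P A * P B)%E.

Definition is_cond_exp (F : set_system T) (X Z : T -> R) : Prop :=
  [/\ P.-integrable setT (EFin \o Z),
      forall B, measurable B -> F (Z @^-1` B) &
      forall A, F A ->
        (\int[P]_(w in A) (Z w)%:E = \int[P]_(w in A) (X w)%:E)%E].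

(* A version of E[X | F]; it exists when X is integrable, see [cond_expP]. *)
Definition cond_exp (F : set_system T) (X : T -> R) : T -> R :=
  xget (cst 0) [set Z | is_cond_exp F X Z].

Lemma cond_expP (C : set_system T) (X : T -> R) :
  C `<=` measurable -> P.-integrable setT (EFin \o X) ->
  is_cond_exp <<s C >> X (cond_exp <<s C >> X).
Proof.
move=> Cm iX.
have Fm : <<s C >> `<=` (measurable : set_system T).
  by apply: smallest_sub => //; exact: sigma_algebra_measurable.
have null (A : set T) : measurable A -> P A = 0%E ->
    (\int[P]_(w in A) (X w)%:E)%E = 0%E.
  move=> mA PA; apply: null_set_integral => //.
  exact/measurable_funTS/(measurable_int P).
have mid : measurable_fun setT (idfun : T -> g_sigma_algebraType C).
  by move=> _ B mB; rewrite setTI; exact: Fm.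
pose f : {mfun T >-> g_sigma_algebraType C} :=
  HB.pack (idfun : T -> g_sigma_algebraType C)
    (isMeasurableFun.Build _ _ T (g_sigma_algebraType C) idfun mid).
pose mu : probability (g_sigma_algebraType C) R := distribution P f.
pose nu0 : {charge set T -> \bar R} := induced_charge iX.
have mf : measurable_fun setT f by exact: mid.
have [nu nuE] : exists nu : {charge set (g_sigma_algebraType C) -> \bar R},
    forall A, nu A = (\int[P]_(w in A) (X w)%:E)%E.
  by unshelve eexists (pushforward nu0 f : {charge set _ -> \bar R}).
have numu : nu `<< mu.
  apply/null_content_dominatesP => A mA muA; rewrite nuE.
  exact: null (Fm _ mA) muA.
have [g [gfin ig gE]] : exists g : g_sigma_algebraType C -> \bar R,
    [/\ (forall x, g x \is a fin_num), mu.-integrable setT g &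
    forall A, measurable A -> nu A = (\int[mu]_(x in A) g x)%E].
  exists (Radon_Nikodym nu mu); split.
  - by move=> x; exact: Radon_Nikodym_fin_num.
  - exact: Radon_Nikodym_integrable.
  - by move=> A mA; exact: Radon_Nikodym_integral.
have gfinE : EFin \o (fine \o g) = g.
  by apply/funext => x /=; rewrite fineK.
have mg : measurable_fun setT g by exact: (measurable_int mu).
have mgf : measurable_fun setT (g \o f).
  by move=> _ B mB; have := mg measurableT B mB; rewrite !setTI; exact: Fm.
have iPg : P.-integrable setT (g \o f).
  apply/integrableP; split => //; have /integrableP[_] := ig.
  by rewrite ge0_integral_pushforward//; exact: measurableT_comp.
suff: exists Z, is_cond_exp <<s C >> X Z by exact: xgetPex.
exists (fine \o g); split; first by rewrite gfinE.
- move=> B mB; have : measurable_fun setT (fine \o g) by exact: measurableT_comp.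
  by move=> /(_ measurableT _ mB); rewrite setTI.
- move=> A FA; under eq_integral do rewrite -/((EFin \o (fine \o g)) _) gfinE.
  rewrite -nuE gE// integral_pushforward//.
  by apply: (integrableS measurableT _ _ iPg) => //; exact: Fm.
Qed.

End probability_notions.

Section convergence_in_law.
Context {d d' : measure_display} {T : measurableType d}.
Context {T' : measurableType d'} {R : realType}.

Definition cvg_in_law (P : probability T R) (X : nat -> T -> R)
    (Q : probability T' R) (W : T' -> R) : Prop :=
  forall f : R -> R, continuous f -> (exists M, forall x, `|f x| <= M) ->
    ('E_P[f \o X N] @[N --> \oo] --> 'E_Q[f \o W])%E.

End convergence_in_law.

(* Rows and columns are numbered from 0, so [n] is {0, ..., n-1}. *)
Definition seg (n : nat) : {fset nat} := [fset k in iota 0 n].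

Definition ksubsets (k : nat) (A : {fset nat}) : {fset {fset nat}} :=
  [fset B in fpowerset A | #|` B| == k].

(* A triple (V1, V2, E) with E included in V1 x V2. *)
Record bigraph := Bigraph {
  gval : {fset nat} * {fset nat} * {fset nat * nat};
  _ : (gval.2 `<=` gval.1.1 `*` gval.1.2)%fset }.

HB.instance Definition _ := [isSub for gval].
HB.instance Definition _ := [Choice of bigraph by <:].

Definition V1 (G : bigraph) : {fset nat} := (gval G).1.1.
Definition V2 (G : bigraph) : {fset nat} := (gval G).1.2.
Definition edges (G : bigraph) : {fset nat * nat} := (gval G).2.
Definition v1 (G : bigraph) : nat := #|` V1 G|.
Definition v2 (G : bigraph) : nat := #|` V2 G|.

Definition empty_graph : bigraph :=
  @Bigraph (fset0, fset0, fset0) (fsub0set _).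

Definition complete_graph (i j : {fset nat}) : bigraph :=
  @Bigraph (i, j, (i `*` j)%fset) (fsubset_refl _).

(* E(F) is included in V1(F) x V2(F) by construction. *)
Definition subgraph (F G : bigraph) : bool :=
  [&& V1 F `<=` V1 G, V2 F `<=` V2 G & edges F `<=` edges G]%fset.

Definition subgraphs (G : bigraph) : {fset bigraph} :=
  [fset F in pmap insub (enum_fset
    (fpowerset (V1 G) `*` fpowerset (V2 G) `*` fpowerset (edges G))%fset)].

Lemma mem_subgraphs F G : (F \in subgraphs G) = subgraph F G.
Proof.
rewrite inE /= mem_pmap_sub /= !in_fsetM /= !fpowersetE.
by rewrite /subgraph andbA.
Qed.

Definition gsize (G : bigraph) : nat := (v1 G + v2 G + #|` edges G|)%N.

Lemma ltn_gsize F G : subgraph F G -> F != G -> (gsize F < gsize G)%N.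
Proof.
case/and3P=> sV1 sV2 sE; apply: contraNltn; rewrite /gsize /v1 /v2 => le_size.
have := (fsubset_leq_card sV1, fsubset_leq_card sV2, fsubset_leq_card sE).
move=> [[lV1 lV2] lE].
have eV1 : V1 F = V1 G by apply/eqP; rewrite eqEfcard sV1; lia.
have eV2 : V2 F = V2 G by apply/eqP; rewrite eqEfcard sV2; lia.
have eE : edges F = edges G by apply/eqP; rewrite eqEfcard sE; lia.
apply/eqP/val_inj; rewrite /= [LHS]surjective_pairing [RHS]surjective_pairing.
congr pair => //; rewrite [LHS]surjective_pairing [RHS]surjective_pairing.
by congr pair.
Qed.

(* Indices of the variables xi i, eta j and zeta i j, in this order. *)
Definition noise_index : choiceType := (nat + nat + nat * nat)%type.

Definition noise_in (G : bigraph) : set noise_index :=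
  fun k => match k with
           | inl (inl i) => i \in V1 G
           | inl (inr j) => j \in V2 G
           | inr e => e \in edges G
           end.

Section row_column_arrays.
Context {d : measure_display} {T : measurableType d} {R : realType}.
Variable P : probability T R.

Definition noise (xi eta : nat -> {RV P >-> R})
    (zeta : nat -> nat -> {RV P >-> R}) (k : noise_index) : T -> R :=
  match k with
  | inl (inl i) => xi i
  | inl (inr j) => eta j
  | inr (i, j) => zeta i j
  end.

Definition uniform01 (X : {RV P >-> R}) : Prop :=
  forall A : set R, measurable A -> distribution P X A = uniform_prob ltr01 A.

Definition row_column_exchangeable (Y : nat -> nat -> {RV P >-> R}) : Prop :=
  forall s1 s2 : nat -> nat, bijective s1 -> bijective s2 ->
    same_law P (fun k : nat * nat => Y (s1 k.1) (s2 k.2) : T -> R)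
               (fun k : nat * nat => Y k.1 k.2 : T -> R).

Definition dissociated (Y : nat -> nat -> {RV P >-> R}) : Prop :=
  forall m n : nat, independent_systems P
    (sigma_gen [set k | (k.1 < m)%N /\ (k.2 < n)%N]
       (fun k : nat * nat => Y k.1 k.2 : T -> R))
    (sigma_gen [set k | (m <= k.1)%N /\ (n <= k.2)%N]
       (fun k : nat * nat => Y k.1 k.2 : T -> R)).

Section projections.
Variable H : noise_index -> T -> R.

(* The recursion is on a bound n for the size of G; [graph_projE] is the
   recursive equation. *)
Fixpoint graph_proj_rec (n : nat) (X : T -> R) (G : bigraph) : T -> R :=
  if n is n'.+1 then
    if G == empty_graph then cst (fine 'E_P[X]) else
    fun w => cond_exp P (sigma_gen (noise_in G) H) X w -
             \sum_(F <- subgraphs G | F != G) graph_proj_rec n' X F w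
  else cst 0.

Definition graph_proj (X : T -> R) (G : bigraph) : T -> R :=
  graph_proj_rec (gsize G).+1 X G.

Lemma graph_proj_empty X : graph_proj X empty_graph = cst (fine 'E_P[X]).
Proof. by rewrite /graph_proj; cbn [graph_proj_rec]; rewrite eqxx. Qed.

Lemma graph_proj_recE n X G :
  (gsize G < n)%N -> graph_proj_rec n X G = graph_proj X G.
Proof.
move=> ltGn; suff eq_rec m k G' : (gsize G' < m)%N -> (gsize G' < k)%N ->
  graph_proj_rec m X G' = graph_proj_rec k X G' by apply: eq_rec.
elim: m k G' => [|m IHm] [|k] G'; rewrite ?ltn0 ?ltnS// => leGm leGk.
cbn [graph_proj_rec].
case: eqP => // _; apply/funext => w; congr (_ - _).
rewrite big_seq_cond [RHS]big_seq_cond; apply: eq_bigr => F /andP[].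
rewrite mem_subgraphs => sFG neFG; have ltFG := ltn_gsize sFG neFG.
by rewrite (IHm k)// (leq_trans ltFG).
Qed.

Lemma graph_projE X G : G != empty_graph ->
  graph_proj X G = fun w => cond_exp P (sigma_gen (noise_in G) H) X w -
                           \sum_(F <- subgraphs G | F != G) graph_proj X F w.
Proof.
move=> /negPf neG; rewrite {1}/graph_proj; cbn [graph_proj_rec]; rewrite neG.
apply/funext => w; congr (_ - _).
rewrite big_seq_cond [RHS]big_seq_cond; apply: eq_bigr => F /andP[].
by rewrite mem_subgraphs => sFG neFG; rewrite graph_proj_recE// ltn_gsize.
Qed.

End projections.

Section u_statistics.
Variables (p q : nat) (h : 'M[R]_(p, q) -> R).
Variables (Y : nat -> nat -> {RV P >-> R}) (H : noise_index -> T -> R).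

(* h evaluated at the submatrix of Y with rows i and columns j, in increasing
   order. *)
Definition hval (i j : {fset nat}) (w : T) : R :=
  h (\matrix_(a < p, b < q)
       Y (nth 0%N (sort leq i) a) (nth 0%N (sort leq j) b) w).

Definition ustat (m n : nat) (w : T) : R :=
  'C(m, p)%:R^-1 * 'C(n, q)%:R^-1 *
  \sum_(i <- ksubsets p (seg m)) \sum_(j <- ksubsets q (seg n)) hval i j w.

(* p^G does not depend on the pair (i, j) used to define it; here (i, j) is
   the pair of the outer sum. *)
Definition ustat_part (r c m n : nat) (w : T) : R :=
  'C(m, p)%:R^-1 * 'C(n, q)%:R^-1 *
  \sum_(i <- ksubsets p (seg m)) \sum_(j <- ksubsets q (seg n))
    \sum_(G <- subgraphs (complete_graph i j) | (v1 G, v2 G) == (r, c))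
      graph_proj H (hval i j) G w.

Definition proj_level (k : nat) (w : T) : R :=
  \sum_(G <- subgraphs (complete_graph (seg p) (seg q)) |
      (v1 G + v2 G)%N == k)
    graph_proj H (hval (seg p) (seg q)) G w.

Definition is_principal_degree (k : nat) : Prop :=
  [/\ (1 <= k <= p + q)%N,
      ~ (\forall w \ae P, proj_level k w = 0) &
      forall l, (1 <= l < k)%N -> \forall w \ae P, proj_level l w = 0].

End u_statistics.
End row_column_arrays.

(* Main.v *)
Require Import Defs.
From HB Require Import structures.
From mathcomp Require Import all_boot all_order all_algebra perm finmap.
From mathcomp Require Import all_classical all_reals all_analysis.
From mathcomp Require Import measurable_realfun.
From mathcomp Require Import zify ring lra.

Set Implicit Arguments.
Unset Strict Implicit.
Unset Printing Implicit Defensive.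

Import Order.TTheory GRing.Theory Num.Theory.
Import numFieldNormedType.Exports.

Local Open Scope classical_set_scope.
Local Open Scope ring_scope.

(** The graph projections form a Hoeffding decomposition. Each kernel value
    [hval h Y i j] is almost surely the sum of the [p^G] over the subgraphs [G] of
    the complete graph on [i], [j] ([hval_sum_proj]), and projections on distinct
    graphs are orthogonal, also when they come from different kernel values
    ([proj_orthogonal]). The reason for orthogonality is that, for independent
    noise variables, conditioning on H(G) and then on H(F) amounts to
    conditioning on the noise common to F and G ([cond_exp_setI]); by induction
    on G, the projection [p^G] then has conditional expectation 0 given any H(F)
    with G not included in F ([proj_centered]).

    Let d be the principal degree. If [p^(k)] vanishes, orthogonality makes each
    of its terms vanish. A term only depends on the labels of the vertices
    through the choice of the noise variables, whose joint law is invariant under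
    relabelling; hence the terms with k vertices vanish for all index sets
    ([proj_null]). Consequently, almost surely, the difference between U_N - p^0
    and the sum of the P_N^{r,c} with r + c = d is the average over (i, j) of the
    [p^G] with more than d vertices ([ustat_decomposition]).

    In the second moment of that average only pairs of terms with the same graph
    contribute. A graph with r row vertices and c column vertices belongs to
    O(N^(p - r + q - c)) of the complete graphs, out of about N^(p + q), so that
    the second moment is O(N^(- d - 1)) ([high_order_sum_bound]). After
    multiplication by N^(d/2), the two sequences of the theorem therefore differ
    by a sequence that tends to 0 in mean square ([remainder_cvg0]), which does
    not affect convergence in law ([cvg_in_law_perturb]). *)

(** * Square-integrable random variables *)

Section integration.
Context {d : measure_display} {T : measurableType d} {R : realType}.
Variable P : probability T R.
Implicit Types (X Y V : T -> R) (A : set T).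

Lemma Lfun1_measurable X : X \in Lfun P 1 -> measurable_fun setT X.
Proof. by move/sub_Lfun_mfun; rewrite inE. Qed.

Lemma Lfun2_measurable X : X \in Lfun P 2%:E -> measurable_fun setT X.
Proof. by move/sub_Lfun_mfun; rewrite inE. Qed.

Lemma Lfun2_sub1 X : X \in Lfun P 2%:E -> X \in Lfun P 1.
Proof.
by apply: Lfun_subset12; rewrite fin_num_measure.
Qed.

Lemma sqr_Lfun2 X : measurable_fun setT X ->
  P.-integrable setT (EFin \o (fun w => X w ^+ 2)) -> X \in Lfun P 2%:E.
Proof.
move=> mX /integrableP[_ iX].
rewrite inE; apply/andP; split; rewrite inE//= /finite_norm unlock /Lnorm.
rewrite poweR_lty//; apply: le_lt_trans iX.
rewrite ge0_le_integral//.
- by move=> x _; rewrite lee_fin powR_ge0.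
- apply/measurable_EFinP.
  apply/(@measurableT_comp _ _ _ _ _ _ (fun x : R => x `^ 2)%R) => //.
  exact/measurableT_comp.
- by apply/measurableT_comp => //; apply/measurable_EFinP; exact: measurable_funX.
- by move=> t _/=; rewrite lee_fin normrX powR_mulrn.
Qed.

Lemma EFin_Rintegral X A : measurable A -> X \in Lfun P 1 ->
  (\int[P]_(w in A) X w)%:E = (\int[P]_(w in A) (X w)%:E)%E.
Proof.
move=> mA /Lfun1_integrable iX; rewrite /Rintegral fineK//.
by apply: integrable_fin_num => //; exact: (integrableS measurableT).
Qed.

Lemma Rintegral_sum (I : eqType) (s : seq I) (p : pred I) (f : I -> T -> R) A :
  measurable A ->
  (forall i, i \in s -> p i -> f i \in Lfun P 1) ->
  \int[P]_(w in A) (\sum_(i <- s | p i) f i w) =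
  \sum_(i <- s | p i) \int[P]_(w in A) f i w.
Proof.
move=> mA; elim: s => [|a s IH] fL1.
  rewrite big_nil; under eq_Rintegral do rewrite big_nil.
  by rewrite Rintegral_cst// mul0r.
have {}IH : \int[P]_(w in A) (\sum_(i <- s | p i) f i w) =
  \sum_(i <- s | p i) \int[P]_(w in A) f i w.
  by apply: IH => i si; apply: fL1; rewrite inE si orbT.
rewrite big_cons; under eq_Rintegral do rewrite big_cons.
case: ifP => // pa; rewrite -IH RintegralD//.
  apply: (integrableS measurableT) => //; apply/Lfun1_integrable.
  by rewrite fL1 ?inE ?eqxx.
apply: (integrableS measurableT) => //; apply/Lfun1_integrable.
rewrite (_ : (fun x => _) = \sum_(i <- s | p i) f i); last first.
  by apply/funext => w; rewrite fct_sumE.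
rewrite big_seq_cond rpred_sum// => i /andP[si pi].
by rewrite fL1// inE si orbT.
Qed.

Lemma mul_Lfun2 X Y : X \in Lfun P 2%:E -> Y \in Lfun P 2%:E ->
  (fun w => X w * Y w) \in Lfun P 1.
Proof. exact: Lfun2_mul_Lfun1. Qed.

Lemma Lfun2B X Y : X \in Lfun P 2%:E -> Y \in Lfun P 2%:E ->
  (fun w => X w - Y w) \in Lfun P 2%:E.
Proof.
move=> XL YL; rewrite -[X in X \in _]/(X \- Y)%R.
by apply: rpredB => //; rewrite lee1n.
Qed.

Lemma Lfun2Z c X : X \in Lfun P 2%:E -> (fun w => c * X w) \in Lfun P 2%:E.
Proof. by move=> XL; apply: (@rpredZ _ _ _ c X) => //; rewrite lee1n. Qed.

Lemma Lfun2_sum (I : eqType) (s : seq I) (p : pred I) (f : I -> T -> R) :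
  (forall i, i \in s -> p i -> f i \in Lfun P 2%:E) ->
  (fun w => \sum_(i <- s | p i) f i w) \in Lfun P 2%:E.
Proof.
move=> fL; rewrite (_ : (fun w => _) = \sum_(i <- s | p i) f i); last first.
  by apply/funext => w; rewrite fct_sumE.
rewrite big_seq_cond; apply: rpred_sum => [|p1 i /andP[si pi]]; first by rewrite lee1n.
exact: fL.
Qed.

Lemma Rintegral_sqrB X Y : X \in Lfun P 2%:E -> Y \in Lfun P 2%:E ->
  \int[P]_w ((X w - Y w) ^+ 2) =
  \int[P]_w (X w ^+ 2) - 2 * \int[P]_w (X w * Y w) + \int[P]_w (Y w ^+ 2).
Proof.
move=> XL YL; have XY := mul_Lfun2 XL YL.
have X2 := Lfun2_integrable_sqr XL; have Y2 := Lfun2_integrable_sqr YL.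
have iXY := (Lfun1_integrable P _).1 XY.
have -> : (fun w => (X w - Y w) ^+ 2) =
    (fun w => (X w ^+ 2 + Y w ^+ 2) - 2 * (X w * Y w)).
  by apply/funext => w; ring.
rewrite RintegralB//; last 2 first.
- exact: (integrableD measurableT X2 Y2).
- exact: (integrableZl measurableT 2 iXY).
by rewrite RintegralD// RintegralZl//; ring.
Qed.

Lemma Rintegral_sum_mul (I : eqType) (s : seq I) (p : pred I) (f : I -> T -> R) Y :
  (forall i, i \in s -> p i -> f i \in Lfun P 2%:E) -> Y \in Lfun P 2%:E ->
  \int[P]_w ((\sum_(i <- s | p i) f i w) * Y w) =
  \sum_(i <- s | p i) \int[P]_w (f i w * Y w).
Proof.
move=> fL YL; under eq_Rintegral do rewrite mulr_suml.
by rewrite Rintegral_sum// => i si pi; exact: mul_Lfun2 (fL i si pi) YL.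
Qed.

Lemma restrict_indic X A : X \_ A = (X \* \1_A)%R.
Proof.
by apply/funext => w; rewrite patchE/= indicE; case: ifP; rewrite (mulr1, mulr0).
Qed.

Lemma Rintegral_indic X A : \int[P]_(w in A) X w = \int[P]_w (X w * \1_A w).
Proof. by rewrite Rintegral_mkcond restrict_indic. Qed.

Lemma Lfun1_indic X A : measurable A -> X \in Lfun P 1 ->
  (X \* \1_A)%R \in Lfun P 1.
Proof.
move=> mA /Lfun1_integrable iX; apply/Lfun1_integrable.
rewrite -restrict_indic -restrict_EFin; apply/integrable_restrict => //.
by rewrite setTI; exact: (integrableS measurableT).
Qed.

Lemma Rintegral_sqr_eq0 X : X \in Lfun P 2%:E -> \int[P]_w (X w ^+ 2) = 0 ->
  \forall w \ae P, X w = 0.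
Proof.
move=> XL X0; have mX := Lfun2_measurable XL.
have X2L : (fun w => X w ^+ 2) \in Lfun P 1.
  by apply/Lfun1_integrable; exact: Lfun2_integrable_sqr.
have /ae_eq_integral_abs : measurable_fun setT (fun w => (X w ^+ 2)%:E).
  by apply/measurable_EFinP; exact: measurable_funX.
move=> /(_ P measurableT)[+ _] => /(_ _)[|].
  under eq_integral do rewrite gee0_abs ?lee_fin ?sqr_ge0//.
  by rewrite -EFin_Rintegral// X0.
move=> N [mN N0 NX]; exists N; split => //; apply: subset_trans NX.
apply: subsetC => w /= /(_ I) [] /eqP; rewrite sqrf_eq0 => /eqP//.
Qed.

(** * Centered variables and conditional expectations *)

(** This is E[V | F] = 0, put in terms of events so that it makes sense for a
    pi-system [F] as well as for a sub-sigma-algebra. *)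
Definition centered (F : set_system T) V :=
  forall A, F A -> \int[P]_(w in A) V w = 0.

Lemma centered_dynkin V : V \in Lfun P 1 -> \int[P]_w V w = 0 ->
  dynkin [set A | measurable A /\ \int[P]_(w in A) V w = 0].
Proof.
move=> VL VT; have iV := (Lfun1_integrable P V).1 VL.
split => /=.
- by split.
- move=> A [mA A0]; split; first exact: measurableC.
  have : \int[P]_(w in A `|` ~` A) V w = 0 by rewrite setUv.
  rewrite Rintegral_setU ?A0 ?add0r//; first exact: measurableC.
    by rewrite setUv.
  by apply/disj_setPS => x [].
- move=> F tF mF; have mU : measurable (\bigcup_k F k).
    by apply: bigcup_measurable => k _; exact: (mF k).1.
  split => //; rewrite /Rintegral integral_bigcup//; last 2 first.
  + by move=> k; exact: (mF k).1.
  + exact: (integrableS measurableT).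
  rewrite eseries0// => k _ _.
  by rewrite -EFin_Rintegral ?(mF k).2//; exact: (mF k).1.
Qed.

(** Dynkin's pi-lambda theorem applies since the events over which [V] integrates
    to 0 form a Dynkin system. *)
Lemma centered_pi (G : set_system T) V :
  setI_closed G -> G `<=` measurable -> G setT -> V \in Lfun P 1 ->
  centered G V -> centered <<s G >> V.
Proof.
move=> GI Gm GT VL GV A; rewrite -setI_closed_g_dynkin_g_sigma_algebra//.
have dV := centered_dynkin VL (GV _ GT).
move=> /(_ [set A | measurable A /\ \int[P]_(w in A) V w = 0])/=.
by case => //; split => // B GB; split; [exact: Gm|exact: GV].
Qed.

Section sub_sigma_algebra.
Variables (C : set_system T).
Hypothesis Cm : C `<=` measurable.

Lemma sub_sigma_measurable : <<s C >> `<=` measurable.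
Proof. by apply: smallest_sub => //; exact: sigma_algebra_measurable. Qed.

Lemma g_sigma_funP (X : T -> R) :
  (forall B, measurable B -> <<s C >> (X @^-1` B)) <->
  measurable_fun (setT : set (g_sigma_algebraType C)) (X : g_sigma_algebraType C -> R).
Proof.
split=> [mX _ B mB|mX B mB]; first by rewrite setTI; exact: mX.
by have := mX measurableT B mB; rewrite setTI.
Qed.

Lemma g_sigma_measurable_fun (f : g_sigma_algebraType C -> R) :
  measurable_fun setT f -> measurable_fun setT (f : T -> R).
Proof.
by move=> mf _ B mB; have := mf measurableT B mB; exact: sub_sigma_measurable.
Qed.

Import HBSimple HBNNSimple.

(** A step function over [<<s C >>] is a combination of indicators of events on
    which [V] integrates to 0. Such functions increase to [Y], and their products
    with [V] are dominated by [|V * Y|]. *)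
Lemma centered_mul_ge0 V (Y : T -> R) : V \in Lfun P 1 -> centered <<s C >> V ->
  (forall B, measurable B -> <<s C >> (Y @^-1` B)) -> (forall w, 0 <= Y w) ->
  (V \* Y)%R \in Lfun P 1 -> \int[P]_w (V w * Y w) = 0.
Proof.
move=> VL V0 /g_sigma_funP mY Y0 VYL.
have mYE : measurable_fun (setT : set (g_sigma_algebraType C)) (EFin \o Y).
  exact/measurable_EFinP.
pose s_ n : {nnsfun g_sigma_algebraType C >-> R} := nnsfun_approx measurableT mYE n.
have s_cvg w : EFin \o s_ ^~ w @ \oo --> (Y w)%:E.
  by apply: (cvg_nnsfun_approx measurableT mYE) => // t _; rewrite lee_fin.
have s_le n w : s_ n w <= Y w.
  rewrite /s_ nnsfun_approxE -lee_fin.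
  by apply: (@le_approx _ _ _ _ (EFin \o Y)) => // t _; rewrite lee_fin.
have mV := Lfun1_measurable VL.
have ms n : measurable_fun setT (s_ n : T -> R).
  by apply: g_sigma_measurable_fun; exact: measurable_funP.
have mYT : measurable_fun setT (Y : T -> R) by exact: g_sigma_measurable_fun.
have s0 n : \int[P]_w (V w * s_ n w) = 0.
  have -> : (fun w => V w * s_ n w) = (fun w =>
      \sum_(y <- fset_set (range (s_ n))) y * (V w * \1_(s_ n @^-1` [set y]) w)).
    apply/funext => w; rewrite {1}(fimfunE (s_ n)) fsbig_finite//= mulr_sumr.
    by apply: eq_bigr => y _; rewrite mulrCA.
  have mI y : <<s C >> (s_ n @^-1` [set y]).
    have : measurable_fun setT (s_ n) by exact: measurable_funP.
    by move=> /(_ measurableT [set y] (measurable_set1 y)); rewrite setTI.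
  have VI y : (V \* \1_(s_ n @^-1` [set y]))%R \in Lfun P 1.
    by apply: Lfun1_indic => //; exact: sub_sigma_measurable.
  rewrite Rintegral_sum//; last first.
    move=> y _ _; rewrite (_ : (fun w => _) = y *: (V \* \1_(s_ n @^-1` [set y]))%R)//.
    exact: rpredZ.
  rewrite big1// => y _.
  rewrite RintegralZl//; last exact: (Lfun1_integrable _ _).1 (VI y).
  by rewrite -Rintegral_indic V0 ?mulr0.
have [|||||_ _ cvg] := @dominated_convergence _ _ _ P setT measurableT
    (fun n w => (V w * s_ n w)%:E) (fun w => (V w * Y w)%:E)
    (abse \o (fun w => (V w * Y w)%:E)).
- by move=> n; apply/measurable_EFinP; exact: measurable_funM.
- by apply/measurable_EFinP; exact: measurable_funM.
- apply: aeW => w _.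
  under eq_fun do rewrite EFinM.
  by rewrite EFinM; apply: cvgeZl => //; exact: s_cvg.
- by apply: integrable_abse; exact/Lfun1_integrable.
- apply: aeW => w n _ /=; rewrite lee_fin !normrM ler_wpM2l//.
  by rewrite !ger0_norm// s_le.
have {}cvg : cst 0%E @ \oo --> (\int[P]_w (V w * Y w)%:E)%E.
  apply: cvg_trans cvg; apply: near_eq_cvg; apply: nearW => n /=.
  rewrite -EFin_Rintegral ?s0//; apply/Lfun1_integrable.
  apply: (@le_integrable _ _ _ _ _ _ _ (fun w => (V w * Y w)%:E)) => //.
  + by apply/measurable_EFinP; exact: measurable_funM.
  + by move=> w _ /=; rewrite lee_fin !normrM ler_wpM2l// !ger0_norm// s_le.
  + exact/Lfun1_integrable.
rewrite /Rintegral; have /cvg_lim <- // := cvg.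
by rewrite lim_cst.
Qed.

(** The reduction to nonnegative [Y] is by positive and negative parts. All
    orthogonality relations below are instances of this lemma. *)
Lemma centered_mul V (Y : T -> R) : V \in Lfun P 1 -> centered <<s C >> V ->
  (forall B, measurable B -> <<s C >> (Y @^-1` B)) ->
  (V \* Y)%R \in Lfun P 1 -> \int[P]_w (V w * Y w) = 0.
Proof.
move=> VL V0 FY VYL; have /g_sigma_funP mY := FY.
have mV := Lfun1_measurable VL.
have mYT : measurable_fun setT (Y : T -> R) by exact: g_sigma_measurable_fun.
have dom (Z : T -> R) : measurable_fun setT Z ->
    (forall w, `|Z w| <= `|Y w|) -> (V \* Z)%R \in Lfun P 1.
  move=> mZ ZY; apply/Lfun1_integrable.
  apply: (@le_integrable _ _ _ _ _ _ _ (fun w => (V w * Y w)%:E)) => //.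
  + by apply/measurable_EFinP; exact: measurable_funM.
  + by move=> w _ /=; rewrite lee_fin !normrM ler_wpM2l.
  + exact/Lfun1_integrable.
have pL : (V \* (fun w => Num.max (Y w) 0))%R \in Lfun P 1.
  apply: dom => [|w]; first exact: measurable_maxr.
  by case: (leP (Y w) 0) => // _; rewrite normr0.
have nL : (V \* (fun w => Num.max (- Y w) 0))%R \in Lfun P 1.
  apply: dom => [|w]; first by apply: measurable_maxr => //; exact: measurable_funN.
  by case: (leP (- Y w) 0) => // _; rewrite ?normr0 ?normrN.
have -> : (fun w => V w * Y w) =
    (fun w => V w * Num.max (Y w) 0 - V w * Num.max (- Y w) 0).
  by apply/funext => w; rewrite -mulrBr; congr (_ * _);
     case: (leP (Y w) 0); case: (leP (- Y w) 0); lra.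
rewrite RintegralB//; [|exact/Lfun1_integrable|exact/Lfun1_integrable].
rewrite !centered_mul_ge0 ?subrr//.
- apply/g_sigma_funP; apply: measurable_maxr => //; exact: measurable_funN.
- by move=> w; rewrite le_max lexx orbT.
- by apply/g_sigma_funP; exact: measurable_maxr.
- by move=> w; rewrite le_max lexx orbT.
Qed.

Section conditional_expectation.
Implicit Types (Z : T -> R).

Lemma is_cond_exp_Lfun1 X Z : is_cond_exp P <<s C >> X Z -> Z \in Lfun P 1.
Proof. by case=> /Lfun1_integrable. Qed.

Lemma is_cond_exp_measurable X Z : is_cond_exp P <<s C >> X Z ->
  forall B, measurable B -> <<s C >> (Z @^-1` B).
Proof. by case. Qed.

Lemma is_cond_expP X Z : X \in Lfun P 1 -> Z \in Lfun P 1 ->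
  (forall B, measurable B -> <<s C >> (Z @^-1` B)) ->
  is_cond_exp P <<s C >> X Z <-> centered <<s C >> (X \- Z).
Proof.
move=> XL ZL mZ; have [iX iZ] := ((Lfun1_integrable P X).1 XL, (Lfun1_integrable P Z).1 ZL).
split=> [[_ _ ZX] A FA | V0]; last split => // A FA; last first;
  have mA := sub_sigma_measurable FA.
  have := V0 A FA; rewrite /= RintegralB//.
  + by move/eqP; rewrite subr_eq0 => /eqP XZ; rewrite -!EFin_Rintegral// XZ.
  + exact: (integrableS measurableT).
  + exact: (integrableS measurableT).
rewrite /= RintegralB//; [|exact: (integrableS measurableT)..].
by rewrite /Rintegral ZX// subrr.
Qed.

(** The truncations [Y n] of [Z] satisfy E[X Y_n] = E[Z Y_n] = E[Y_n^2], so that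
    0 <= E[(X - Y_n)^2] bounds E[Y_n^2] by E[X^2]; monotone convergence removes
    the truncation. *)
Lemma cond_exp_Lfun2 X Z : X \in Lfun P 2%:E -> is_cond_exp P <<s C >> X Z ->
  Z \in Lfun P 2%:E.
Proof.
move=> XL ceZ; have XL1 := Lfun2_sub1 XL; have ZL := is_cond_exp_Lfun1 ceZ.
have FZ := is_cond_exp_measurable ceZ; have /g_sigma_funP mZ := FZ.
have mZT := Lfun1_measurable ZL.
have XZ0 := (is_cond_expP XL1 ZL FZ).1 ceZ.
pose A n := [set w | `|Z w| <= n%:R].
have mA n : measurable_fun (setT : set (g_sigma_algebraType C))
    (\1_(A n) : g_sigma_algebraType C -> R).
  apply/measurable_indicP; rewrite -[A n]setTI; apply: measurable_fun_le => //.
  exact: measurableT_comp.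
pose Y n := (Z \* \1_(A n))%R.
have FY n : forall B, measurable B -> <<s C >> (Y n @^-1` B).
  by apply/g_sigma_funP; exact: measurable_funM.
have Yn n w : `|Y n w| <= n%:R.
  rewrite /Y/= indicE; have [|_] := boolP (w \in A n).
    by rewrite inE mulr1.
  by rewrite mulr0 normr0.
have mY n : measurable_fun setT (Y n : T -> R).
  by have /g_sigma_funP := FY n; exact: g_sigma_measurable_fun.
have YL n : Y n \in Lfun P 2%:E.
  apply: sqr_Lfun2 => //; apply: measurable_bounded_integrable => //.
  - by rewrite ltey_eq fin_num_measure.
  - exact: measurable_funX.
  - exists (n%:R ^+ 2); split; first exact: num_real.
    move=> M /ltW nM w _ /=; rewrite normrX; apply: le_trans nM.
    by rewrite lerXn2r ?nnegrE.
have Y2 n : (fun w => Y n w ^+ 2) \in Lfun P 1.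
  by apply/Lfun1_integrable; exact: Lfun2_integrable_sqr.
have X2 : (fun w => X w ^+ 2) \in Lfun P 1.
  by apply/Lfun1_integrable; exact: Lfun2_integrable_sqr.
have YZ n w : Y n w * Z w = Y n w ^+ 2.
  by rewrite /Y/= indicE; case: (w \in A n); rewrite ?mulr1 ?mulr0 ?mul0r ?expr0n ?expr2.
have bound n : \int[P]_w (Y n w ^+ 2) <= \int[P]_w (X w ^+ 2).
  have : \int[P]_w ((X w - Z w) * Y n w) = 0.
    apply: (centered_mul (V := (X \- Z)%R)) => //; [exact: rpredB|exact: FY|].
    rewrite (_ : (_ \* _)%R = (fun w => X w * Y n w) - (fun w => Y n w ^+ 2)).
      by apply: rpredB => //; exact: mul_Lfun2.
    by apply/funext => w /=; rewrite !fctE /= mulrBl [Z w * _]mulrC YZ.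
  under eq_Rintegral do rewrite mulrBl [X in _ - X]mulrC YZ.
  rewrite RintegralB//; last 2 first.
    exact/Lfun1_integrable/mul_Lfun2.
    exact/Lfun1_integrable.
  move/eqP; rewrite subr_eq0 => /eqP XY.
  have : 0 <= \int[P]_w ((X w - Y n w) ^+ 2).
    by apply: Rintegral_ge0 => w _; exact: sqr_ge0.
  by rewrite Rintegral_sqrB// XY; lra.
apply: sqr_Lfun2 => //; apply/integrableP; split.
  by apply/measurable_EFinP; exact: measurable_funX.
have cvgY w : (Y n w ^+ 2)%:E @[n --> \oo] --> (Z w ^+ 2)%:E.
  apply: cvg_near_cst; near=> n.
  rewrite /Y/= indicE mem_set ?mulr1//=.
  near: n; exact: nbhs_infty_ger.
have ndY w : nondecreasing_seq (fun n => (Y n w ^+ 2)%:E).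
  move=> a b ab; rewrite lee_fin /Y/= !indicE.
  have [|_] := boolP (w \in A a); last by rewrite mulr0 expr0n/= sqr_ge0.
  rewrite inE => Aa; have -> // : w \in A b.
  by rewrite inE /A/= (le_trans Aa)// ler_nat.
have cvgI := @cvg_monotone_convergence _ _ _ P setT measurableT
  (fun n w => (Y n w ^+ 2)%:E).
under eq_integral do rewrite gee0_abs ?lee_fin ?sqr_ge0//.
under eq_integral => w _ do rewrite /= -(cvg_lim _ (cvgY w))//.
have : (\int[P]_w (X w ^+ 2)%:E < +oo)%E by rewrite -EFin_Rintegral// ltry.
apply: le_lt_trans; apply: (cvge_le _ (cvgI _ _ _)).
- by apply: nearW => n; rewrite -!EFin_Rintegral// lee_fin.
- by move=> n; apply/measurable_EFinP; exact: measurable_funX.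
- by move=> n w _; rewrite lee_fin sqr_ge0.
- by move=> w _; exact: ndY.
Unshelve. all: by end_near. Qed.

End conditional_expectation.
End sub_sigma_algebra.
End integration.

(** * Conditioning on parts of an independent family *)

Section independence.
Context {d : measure_display} {T : measurableType d} {R : realType}.
Variables (P : probability T R) (I : choiceType) (H : I -> T -> R).
Hypothesis mH : forall k, measurable_fun setT (H k).
Implicit Types (D E : set I) (A : set T).

(** A pi-system that generates [sigma_gen D H], on which mutual independence is
    directly the product formula. *)
Definition cylinder D : set_system T :=
  [set A | exists (J : {fset I}) (B : I -> set R), [/\ [set` J] `<=` D,
    (forall k, measurable (B k)) & A = \bigcap_(k in [set` J]) (H k @^-1` B k)]].

Lemma cylinderT D : cylinder D setT.
Proof.
exists fset0, (fun=> setT); split => //.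
by rewrite set_fset0 bigcap_set0.
Qed.

Lemma cylinderI D : setI_closed (cylinder D).
Proof.
move=> _ _ [J [B [JD mB ->]]] [J' [B' [JD' mB' ->]]].
exists (J `|` J')%fset, (fun k => (if k \in J then B k else setT) `&`
  (if k \in J' then B' k else setT)); split.
- by move=> k /=; rewrite inE => /orP[/JD|/JD'].
- by move=> k; apply: measurableI; case: ifP.
- apply/seteqP; split=> w /=.
    move=> [wJ wJ'] k /= _; split.
      by case: ifP => // kJ; exact: wJ.
    by case: ifP => // kJ; exact: wJ'.
  move=> wJ; split=> k /= kJ.
    by have := wJ k; rewrite /= inE kJ => /(_ isT)[].
  by have := wJ k; rewrite /= inE kJ orbT => /(_ isT)[].
Qed.

Lemma sigma_gen_gens D :
  \bigcup_(k in D) preimage_set_system setT (H k) measurable `<=` measurable.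
Proof. by move=> A [k _ [B mB <-]]; exact: mH. Qed.

Lemma cylinder_sigma_gen D : cylinder D `<=` sigma_gen D H.
Proof.
move=> _ [J [B [JD mB ->]]].
apply: (@fin_bigcap_measurable _ (g_sigma_algebraType
  (\bigcup_(k in D) preimage_set_system setT (H k) measurable)) I) => //.
move=> k kJ; apply: sub_sigma_algebra; exists k; first exact: JD.
by exists (B k); rewrite ?setTI.
Qed.

Lemma sigma_gen_measurable D : sigma_gen D H `<=` measurable.
Proof. exact/sub_sigma_measurable/sigma_gen_gens. Qed.

Lemma cylinder_measurable D : cylinder D `<=` measurable.
Proof. by move=> A /cylinder_sigma_gen; exact: sigma_gen_measurable. Qed.

Lemma sigma_gen_cylinder D : sigma_gen D H = <<s cylinder D >>.
Proof.
apply/seteqP; split; last first.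
  apply: smallest_sub; last exact: cylinder_sigma_gen.
  exact: smallest_sigma_algebra.
apply: smallest_sub; first exact: smallest_sigma_algebra.
move=> A [k kD [B mB <-]]; apply: sub_sigma_algebra.
exists [fset k]%fset, (fun=> B); split => //.
  by move=> l /=; rewrite inE => /eqP ->.
rewrite setTI; apply/seteqP; split=> w /=.
  by move=> kw l /=; rewrite inE => /eqP ->.
by move=> /(_ k) /=; rewrite inE eqxx => /(_ isT).
Qed.

Lemma sigma_genS D E : D `<=` E -> sigma_gen D H `<=` sigma_gen E H.
Proof.
move=> DE; apply: smallest_sub; first exact: smallest_sigma_algebra.
move=> A [k kD kA]; apply: sub_sigma_algebra; exists k => //; exact: DE.
Qed.

Lemma centered_cylinder D V : V \in Lfun P 1 ->
  centered P (cylinder D) V -> centered P (sigma_gen D H) V.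
Proof.
rewrite sigma_gen_cylinder; apply: centered_pi.
- exact: cylinderI.
- exact: cylinder_measurable.
- exact: cylinderT.
Qed.

Hypothesis indep : mutually_independent P H.

Lemma cylinder_indep D E A A' : D `&` E = set0 -> cylinder D A -> cylinder E A' ->
  P (A `&` A') = (P A * P A')%E.
Proof.
move=> DE [J [B [JD mB ->]]] [J' [B' [JE mB' ->]]].
have JJ' k : k \in J -> k \in J' = false.
  move=> kJ; apply/negP => kJ'; have : (D `&` E) k by split; [exact: JD|exact: JE].
  by rewrite DE.
pose C k := if k \in J then B k else B' k.
have mC k : measurable (C k) by rewrite /C; case: ifP.
have -> : \bigcap_(k in [set` J]) H k @^-1` B k `&`
    \bigcap_(k in [set` J']) H k @^-1` B' k =
    \bigcap_(k in [set` (J `|` J')%fset]) H k @^-1` C k.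
  apply/seteqP; split=> w /=.
    move=> [wJ wJ'] k /=; rewrite /C inE; case: ifP => kJ /=; first by move=> _; exact: wJ.
    by move=> kJ'; exact: wJ'.
  move=> wC; split=> k /= kJ; have := wC k; rewrite /= inE kJ ?orbT => /(_ isT).
    by rewrite /C kJ.
  by rewrite /C; case: ifP => // /JJ'; rewrite kJ.
rewrite !indep// (big_fsetID _ (mem J)) /=; congr (_ * _)%E.
  apply: eq_fbig_cond => k; rewrite ?inE/=.
    rewrite !andbT; apply/idP/idP => [/andP[_ kJ]|kJ]; first exact: kJ.
    by have {}kJ : k \in J by []; rewrite kJ.
  by rewrite /C => /andP[_ ->].
apply: eq_fbig_cond => k; rewrite ?inE/=.
  rewrite !andbT; apply/idP/idP => [/andP[/orP[->|]]|kJ]//.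
  have {}kJ : k \in J' by []; rewrite kJ orbT/=.
  by apply/negP => /JJ'; rewrite kJ.
by rewrite /C => /andP[_ /negbTE ->].
Qed.

(** [1_A - P A] is centered on the cylinders of [D], from which [A] is
    independent, hence on the sigma-algebra that they generate. *)
Lemma Rintegral_indep D E A (X : T -> R) : D `&` E = set0 -> cylinder E A ->
  X \in Lfun P 1 -> (forall B, measurable B -> sigma_gen D H (X @^-1` B)) ->
  \int[P]_(w in A) X w = fine (P A) * \int[P]_w X w.
Proof.
move=> DE cA XL FX; have mA := cylinder_measurable cA.
pose V : T -> R := (\1_A \- cst (fine (P A)))%R.
have indL (B : set T) : measurable B -> \1_B \in Lfun P 1.
  by move=> mB; apply/Lfun1_integrable; exact: integrable_indic.
have cL c : cst c \in Lfun P 1.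
  by apply/Lfun1_integrable; exact: finite_measure_integrable_cst.
have VL : V \in Lfun P 1 by apply: rpredB; [exact: indL|exact: cL].
have V0 : centered P (sigma_gen D H) V.
  apply: centered_cylinder => // B cB; have mB := cylinder_measurable cB.
  rewrite /V /= RintegralB//; [|
    by apply: (integrableS measurableT) => //; exact/Lfun1_integrable/indL|
    by apply: (integrableS measurableT) => //; exact/Lfun1_integrable/cL].
  rewrite Rintegral_cst// /Rintegral integral_indic// setIC.
  rewrite [X in fine X - _](_ : _ = (P B * P A)%E); last exact: cylinder_indep DE cB cA.
  by rewrite fineM ?fin_num_measure// mulrC subrr.
have VX : \int[P]_w (V w * X w) = 0.
  apply: (centered_mul (sigma_gen_gens (D := D))) => //.
  rewrite (_ : (_ \* _)%R = (X \* \1_A)%R - fine (P A) *: X).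
    by rewrite rpredB ?rpredZ// Lfun1_indic.
  by apply/funext => w; rewrite /V /= !fctE /= mulrBl mulrC.
move: VX; under eq_Rintegral do rewrite /V /= mulrBl mulrC.
rewrite RintegralB//; [|exact/Lfun1_integrable/Lfun1_indic|
  by apply/Lfun1_integrable; exact: (@rpredZ _ _ _ (fine (P A)) X)].
rewrite RintegralZl//; last exact/Lfun1_integrable.
by rewrite -Rintegral_indic => /eqP; rewrite subr_eq0 => /eqP.
Qed.

Lemma cylinder_split D E A : cylinder E A ->
  exists A1 A2, [/\ cylinder (E `&` D) A1, cylinder (E `\` D) A2 & A = A1 `&` A2].
Proof.
move=> [J [B [JE mB ->]]].
exists (\bigcap_(k in [set` [fset k in J | `[< D k >]]%fset]) H k @^-1` B k).
exists (\bigcap_(k in [set` [fset k in J | ~~ `[< D k >]]%fset]) H k @^-1` B k).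
split.
- exists [fset k in J | `[< D k >]]%fset, B; split => // k /=.
  by rewrite !inE => /andP[/JE kE /asboolP kD].
- exists [fset k in J | ~~ `[< D k >]]%fset, B; split => // k /=.
  by rewrite !inE => /andP[/JE kE /asboolP kD].
- apply/seteqP; split=> w /=.
    by move=> wJ; split=> k /=; rewrite !inE => /andP[kJ _]; exact: wJ.
  move=> [w1 w2] k /= kJ; case: (boolP `[< D k >]) => kD.
    by apply: w1; rewrite /= !inE kJ.
  by apply: w2; rewrite /= !inE kJ.
Qed.

(** This is E[E[X | D] | E] = E[X | E `&` D]. It is enough to test it on the
    cylinders of [E]. Each one is the intersection of an event on the variables
    common to [D] and [E] and of an event independent of those in [D]; the
    probability of the latter factors out of both integrals. *)
Lemma cond_exp_setI D E (X Z Z' : T -> R) : X \in Lfun P 1 ->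
  is_cond_exp P (sigma_gen D H) X Z ->
  is_cond_exp P (sigma_gen (E `&` D) H) X Z' ->
  centered P (sigma_gen E H) (Z \- Z')%R.
Proof.
move=> XL ceZ ceZ'.
have [ZL ZL'] := (is_cond_exp_Lfun1 ceZ, is_cond_exp_Lfun1 ceZ').
have sub : sigma_gen (E `&` D) H `<=` sigma_gen D H.
  by apply: sigma_genS; exact: subIsetr.
apply: centered_cylinder; first exact: rpredB.
move=> _ /(cylinder_split D)[A1 [A2 [cA1 cA2 ->]]].
have FA1 := cylinder_sigma_gen cA1.
have [mA1 mA2] := (cylinder_measurable cA1, cylinder_measurable cA2).
have int (U : T -> R) : U \in Lfun P 1 ->
    (forall B, measurable B -> sigma_gen D H (U @^-1` B)) ->
    \int[P]_(w in A1 `&` A2) U w = fine (P A2) * \int[P]_(w in A1) U w.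
  move=> UL FU; rewrite setIC Rintegral_mkcondr restrict_indic.
  rewrite (Rintegral_indep (D := D) _ cA2).
  - by rewrite -Rintegral_indic.
  - by apply/seteqP; split => // k /= [kD [_ /(_ kD)]].
  - exact: Lfun1_indic.
  - apply/g_sigma_funP; apply: measurable_funM; first exact/g_sigma_funP.
    by apply/measurable_indicP; exact: sub.
have mI : measurable (A1 `&` A2) by exact: measurableI.
rewrite /= RintegralB//; [|
  by apply: (integrableS measurableT) => //; exact/Lfun1_integrable..].
rewrite !int//; last 2 first.
- by move=> B mB; apply: sub; exact: (is_cond_exp_measurable ceZ').
- exact: (is_cond_exp_measurable ceZ).
have [_ _ iZ] := ceZ; have [_ _ iZ'] := ceZ'.
by rewrite /Rintegral iZ ?iZ' ?subrr//; exact: sub.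
Qed.

End independence.

(** * Finite bipartite graphs *)

Lemma bigraphP (F G : bigraph) :
  V1 F = V1 G -> V2 F = V2 G -> edges F = edges G -> F = G.
Proof.
case: F G => [[[a b] e] pF] [[[a' b'] e'] pG].
rewrite /V1 /V2 /edges /= => ea eb ee; subst.
by apply: val_inj.
Qed.

Lemma subgraph_refl : reflexive subgraph.
Proof. by move=> G; rewrite /subgraph !fsubset_refl. Qed.

Lemma subgraph_anti : antisymmetric subgraph.
Proof.
move=> F G /andP[/and3P[a b c] /and3P[a' b' c']].
by apply: bigraphP; apply/eqP; rewrite eqEfsubset ?a ?a' ?b ?b' ?c ?c'.
Qed.

Lemma subgraph_empty F : subgraph F empty_graph -> F = empty_graph.
Proof.
move=> FE; apply: subgraph_anti; rewrite FE /=.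
by rewrite /subgraph !fsub0set.
Qed.

Lemma subgraph_ind (Q : bigraph -> Prop) :
  (forall G, (forall F, subgraph F G -> F != G -> Q F) -> Q G) ->
  forall G, Q G.
Proof.
move=> IH G; have [n] := ubnP (gsize G); elim: n G => // n IHn G lt.
by apply: IH => F FG nFG; apply: IHn; have := ltn_gsize FG nFG; lia.
Qed.

Lemma cap_graph_subproof (F G : bigraph) :
  (edges F `&` edges G `<=` (V1 F `&` V1 G) `*` (V2 F `&` V2 G))%fset.
Proof.
apply/fsubsetP => -[i j]; rewrite inE => /andP[eF eG].
have := (fsubsetP (valP F) _ eF, fsubsetP (valP G) _ eG).
by rewrite !inE /= => -[/andP[-> ->] /andP[-> ->]].
Qed.

Definition cap_graph (F G : bigraph) : bigraph :=
  @Bigraph (_, _, _) (cap_graph_subproof F G).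

Lemma sub_cap_graph F G K : subgraph K (cap_graph F G) = subgraph K F && subgraph K G.
Proof.
rewrite /subgraph /cap_graph /V1 /V2 /edges /= !fsubsetI.
by do !case: (_ `<=` _)%fset.
Qed.

Lemma noise_in_cap F G : noise_in (cap_graph F G) = noise_in F `&` noise_in G.
Proof.
apply/seteqP; split=> -[[i|j]|e] /=; rewrite /cap_graph /V1 /V2 /edges /= inE.
all: try by move/andP.
all: by move=> [-> ->].
Qed.

Lemma noise_in_empty : noise_in empty_graph = set0.
Proof. by apply/seteqP; split=> -[[i|j]|e]. Qed.

(** * Graph projections as an orthogonal decomposition *)

Section projections.
Context {d : measure_display} {T : measurableType d} {R : realType}.
Variables (P : probability T R) (H : noise_index -> T -> R).
Hypothesis mH : forall k, measurable_fun setT (H k).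
Implicit Types (X Y : T -> R) (F G : bigraph).

Local Notation proj := (graph_proj P H).
Local Notation sg G := (sigma_gen (noise_in G) H).

Definition proj_sum X G w := \sum_(F <- subgraphs G) proj X F w.

Lemma proj_sumE X G w :
  proj_sum X G w = proj X G w + \sum_(F <- subgraphs G | F != G) proj X F w.
Proof.
by rewrite /proj_sum (bigD1_seq G) ?fset_uniq ?mem_subgraphs ?subgraph_refl.
Qed.

Lemma proj_sum_empty X : proj_sum X empty_graph = cst (fine ('E_P[X])%E).
Proof.
apply/funext => w; rewrite proj_sumE graph_proj_empty big_seq_cond big_pred0 ?addr0//.
move=> F; apply/negP => /andP[]; rewrite mem_subgraphs => /subgraph_empty ->.
by rewrite eqxx.
Qed.

(** The recursion that defines the projections says that their sum over the
    subgraphs of [G] is E[X | H(G)]. For the empty graph this sigma-algebra is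
    trivial and the sum is the mean. *)
Lemma proj_sum_cond_exp X G : X \in Lfun P 1 ->
  is_cond_exp P (sg G) X (proj_sum X G).
Proof.
move=> XL; have iX := (Lfun1_integrable P X).1 XL.
have [->|nG] := eqVneq G empty_graph; last first.
  rewrite (_ : proj_sum X G = cond_exp P (sg G) X); last first.
    by apply/funext => w; rewrite proj_sumE graph_projE// subrK.
  by apply: cond_expP => //; exact: sigma_gen_gens.
rewrite proj_sum_empty noise_in_empty.
have cL : cst (fine ('E_P[X])%E) \in Lfun P 1.
  by apply/Lfun1_integrable; exact: finite_measure_integrable_cst.
apply/is_cond_expP => //.
- exact: sigma_gen_gens.
- by apply/g_sigma_funP; exact: measurable_cst.
- apply: (centered_cylinder mH); first exact: rpredB.
  move=> _ [J [B [J0 mB ->]]]; have -> : [set` J] = set0 by apply/seteqP; split.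
  rewrite bigcap_set0 /= RintegralB//; last exact/Lfun1_integrable.
  rewrite Rintegral_cst// [X in _ * fine X](_ : _ = 1%E); last exact: (probability_setT P).
  by rewrite mulr1 /Rintegral unlock subrr.
Qed.

Section square_integrable_variable.
Variable X : T -> R.
Hypothesis XL : X \in Lfun P 2%:E.

Lemma proj_sum_Lfun2 G : proj_sum X G \in Lfun P 2%:E.
Proof.
apply: (cond_exp_Lfun2 (sigma_gen_gens mH (D := noise_in G)) XL).
exact/proj_sum_cond_exp/Lfun2_sub1.
Qed.

Lemma proj_sum_measurable G B : measurable B -> sg G (proj_sum X G @^-1` B).
Proof. by move: B; case: (proj_sum_cond_exp G (Lfun2_sub1 XL)). Qed.

Lemma projE G : proj X G =
  (fun w => proj_sum X G w - \sum_(F <- subgraphs G | F != G) proj X F w).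
Proof. by apply/funext => w; rewrite proj_sumE addrK. Qed.

Lemma noise_inS F G : subgraph F G -> noise_in F `<=` noise_in G.
Proof.
move=> /and3P[/fsubsetP a /fsubsetP b /fsubsetP c] [[i|j]|e] /=;
  [exact: a|exact: b|exact: c].
Qed.

Lemma proj_Lfun2 G : proj X G \in Lfun P 2%:E.
Proof.
elim/subgraph_ind: G => G IH; rewrite projE.
apply: Lfun2B; first exact: proj_sum_Lfun2.
by apply: Lfun2_sum => F; rewrite mem_subgraphs; exact: IH.
Qed.

Lemma proj_measurable G B : measurable B -> sg G (proj X G @^-1` B).
Proof.
elim/subgraph_ind: G B => G IH; apply/g_sigma_funP; rewrite projE.
apply: measurable_funB; first by apply/g_sigma_funP; exact: proj_sum_measurable.
pose f F := if subgraph F G && (F != G) then proj X F else cst 0.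
have -> : (fun w => \sum_(F <- subgraphs G | F != G) proj X F w) =
    (fun w => \sum_(F <- subgraphs G | F != G) f F w).
  apply/funext => w; rewrite big_seq_cond [RHS]big_seq_cond.
  by apply: eq_bigr => F; rewrite mem_subgraphs /f => ->.
rewrite (_ : (fun w => _) = (fun w => \sum_(F <- [seq F <- subgraphs G | F != G]) f F w));
  last by apply/funext => w; rewrite big_filter.
apply: measurable_sum => F; rewrite /f; case: ifPn => // /andP[sFG nFG].
apply/g_sigma_funP => B mB; apply: (sigma_genS (noise_inS sFG)).
exact: IH.
Qed.

Hypothesis indep : mutually_independent P H.

(** By induction on [G]: in p^G = E[X | H(G)] - (sum of the smaller p^F), the terms
    with F included in [E] add up to E[X | H(K)], where K is the common part of
    [G] and [E], because K is a proper subgraph of [G]. By [cond_exp_setI] this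
    cancels E[X | H(G)] on the events of [E]; the other terms are centered there by
    induction. *)
Lemma proj_centered G E : ~~ subgraph G E -> centered P (sg E) (proj X G).
Proof.
elim/subgraph_ind: G E => G IH E nGE A sA.
have mA := sigma_gen_measurable mH sA.
pose K := cap_graph E G.
have -> : proj X G = (fun w => (proj_sum X G w - proj_sum X K w) -
    \sum_(F <- subgraphs G | (F != G) && ~~ subgraph F E) proj X F w).
  apply/funext => w; rewrite {1}projE -addrA -opprD; congr (_ - _).
  rewrite (bigID (subgraph ^~ E))/=; congr (_ + _).
  rewrite /proj_sum -[LHS]big_filter; apply: perm_big.
  apply: uniq_perm; rewrite ?filter_uniq ?fset_uniq// => F.
  rewrite mem_filter !mem_subgraphs sub_cap_graph.
  have [->|nFG] /= := eqVneq F G; first by rewrite (negbTE nGE).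
  by [].
have L1 F : proj X F \in Lfun P 1 by exact/Lfun2_sub1/proj_Lfun2.
have int (Z : T -> R) : Z \in Lfun P 2%:E -> P.-integrable A (EFin \o Z).
  move=> /Lfun2_sub1/Lfun1_integrable; exact: integrableS.
rewrite RintegralB//; last 2 first.
- by apply: int; apply: Lfun2B; exact: proj_sum_Lfun2.
- by apply: int; apply: Lfun2_sum => F _ _; exact: proj_Lfun2.
rewrite Rintegral_sum// big_seq_cond big1 ?subr0.
  apply: (cond_exp_setI mH indep (Lfun2_sub1 XL) (E := noise_in E)) => //.
  - exact/proj_sum_cond_exp/Lfun2_sub1.
  - rewrite -noise_in_cap; exact/proj_sum_cond_exp/Lfun2_sub1.
move=> F /and3P[]; rewrite mem_subgraphs => FG nFG nFE.
exact: (IH F FG nFG E nFE A sA).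
Qed.

Lemma Rintegral_proj_sum_mul G :
  \int[P]_w (X w * proj X G w) = \int[P]_w (proj_sum X G w * proj X G w).
Proof.
have [XL1 SL1] := (Lfun2_sub1 XL, Lfun2_sub1 (proj_sum_Lfun2 G)).
have XS : centered P (sg G) (X \- proj_sum X G).
  by apply/is_cond_expP => //; [exact: sigma_gen_gens|exact: proj_sum_measurable|
    exact: proj_sum_cond_exp].
have pL := proj_Lfun2 G.
apply/eqP; rewrite -subr_eq0 -RintegralB//; last 2 first.
- by apply/Lfun1_integrable; exact: mul_Lfun2.
- by apply/Lfun1_integrable; apply: mul_Lfun2 => //; exact: proj_sum_Lfun2.
under eq_Rintegral do rewrite -mulrBl.
apply/eqP; apply: (centered_mul (sigma_gen_gens mH (D := noise_in G))
  (V := (X \- proj_sum X G)%R)) => //.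
- exact: rpredB.
- exact: proj_measurable.
- by apply: mul_Lfun2 => //; apply: Lfun2B => //; exact: proj_sum_Lfun2.
Qed.

End square_integrable_variable.

(** Of two distinct graphs, one is not a subgraph of the other. Its projection is
    centered on the noise of the other graph, with respect to which the other
    projection is measurable. *)
Lemma proj_orthogonal X Y F G : mutually_independent P H ->
  X \in Lfun P 2%:E -> Y \in Lfun P 2%:E ->
  F != G -> \int[P]_w (proj X F w * proj Y G w) = 0.
Proof.
move=> indep XL YL nFG.
have ort X' Y' F' G' : X' \in Lfun P 2%:E -> Y' \in Lfun P 2%:E ->
    ~~ subgraph F' G' -> \int[P]_w (proj X' F' w * proj Y' G' w) = 0.
  move=> XL' YL' nFG'; have pL := proj_Lfun2 XL' F'.
  apply: (centered_mul (sigma_gen_gens mH (D := noise_in G'))) => //.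
  - exact: Lfun2_sub1.
  - exact: proj_centered.
  - exact: proj_measurable.
  - by apply: mul_Lfun2 => //; exact: proj_Lfun2.
have [FG|nF] := boolP (subgraph F G); last exact: ort.
under eq_Rintegral do rewrite mulrC; apply: ort => //.
by apply: contra nFG => GF; apply/eqP/subgraph_anti; rewrite FG.
Qed.

(** By orthogonality E[X p^G] = E[(p^G)^2], so that
    E[X^2] - E[(p^G)^2] = E[(X - p^G)^2]. *)
Lemma proj_sqr_le X G : mutually_independent P H -> X \in Lfun P 2%:E ->
  \int[P]_w (proj X G w ^+ 2) <= \int[P]_w (X w ^+ 2).
Proof.
move=> indep XL; have pL := proj_Lfun2 XL G.
have Xp : \int[P]_w (X w * proj X G w) = \int[P]_w (proj X G w ^+ 2).
  rewrite (Rintegral_proj_sum_mul XL) /proj_sum Rintegral_sum_mul//; last first.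
    by move=> F _ _; exact: proj_Lfun2.
  rewrite (bigD1_seq G) ?fset_uniq ?mem_subgraphs ?subgraph_refl//= big1 ?addr0//.
  by move=> F nFG; exact: proj_orthogonal.
have : 0 <= \int[P]_w ((X w - proj X G w) ^+ 2).
  by apply: Rintegral_ge0 => w _; exact: sqr_ge0.
by rewrite (Rintegral_sqrB XL pL) Xp; lra.
Qed.

End projections.

(** * Transport of graph projections along a change of probability space *)

Section almost_everywhere.
Context {d : measure_display} {T : measurableType d} {R : realType}.
Variable P : probability T R.
Implicit Types (X Y : T -> R).

Lemma ae_sum (I : eqType) (s : seq I) (p : pred I) (f g : I -> T -> R) :
  (forall i, i \in s -> p i -> \forall w \ae P, f i w = g i w) ->
  \forall w \ae P, \sum_(i <- s | p i) f i w = \sum_(i <- s | p i) g i w.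
Proof.
elim: s => [|a s IH] fg; first by apply: aeW => w; rewrite !big_nil.
have {}IH := IH (fun i si => fg i (mem_behead (s := a :: s) si)).
have [pa|npa] := boolP (p a); last first.
  by apply: filterS IH => w e; rewrite !big_cons (negbTE npa).
have := fg a (mem_head a s) pa; apply: filterS2 IH => w e1 e2.
by rewrite !big_cons pa e1 e2.
Qed.

Lemma ae_Rintegral A X Y : measurable A -> measurable_fun setT X -> measurable_fun setT Y ->
  (\forall w \ae P, X w = Y w) -> \int[P]_(w in A) X w = \int[P]_(w in A) Y w.
Proof.
move=> mA mX mY XY; rewrite /Rintegral; congr fine; apply: ae_eq_integral => //.
- by apply/measurable_EFinP; exact: measurable_funTS.
- by apply/measurable_EFinP; exact: measurable_funTS.
- by apply: filterS XY => w -> _.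
Qed.

Lemma ae_integrable X Y : measurable_fun setT X -> measurable_fun setT Y ->
  (\forall w \ae P, X w = Y w) ->
  P.-integrable setT (EFin \o X) -> P.-integrable setT (EFin \o Y).
Proof.
move=> mX mY XY /integrableP[_ iX]; apply/integrableP; split.
  exact/measurable_EFinP.
rewrite (le_lt_trans _ iX)// le_eqVlt; apply/orP; left; apply/eqP.
apply: ae_eq_integral => //; try by apply/measurable_EFinP; exact: measurableT_comp.
by apply: filterS XY => w /= -> _.
Qed.

Lemma ae_Lfun2 X Y : measurable_fun setT Y ->
  (\forall w \ae P, X w = Y w) -> X \in Lfun P 2%:E -> Y \in Lfun P 2%:E.
Proof.
move=> mY XY XL; have mX := Lfun2_measurable XL; apply: sqr_Lfun2 => //.
apply: (ae_integrable _ _ _ (Lfun2_integrable_sqr XL)).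
- exact: measurable_funX.
- exact: measurable_funX.
- by apply: filterS XY => w ->.
Qed.

Variable C : set_system T.
Hypothesis Cm : C `<=` measurable.

Lemma is_cond_exp_ae X Y Z : measurable_fun setT X -> measurable_fun setT Y ->
  (\forall w \ae P, X w = Y w) ->
  is_cond_exp P <<s C >> X Z -> is_cond_exp P <<s C >> Y Z.
Proof.
move=> mX mY XY [iZ FZ ZX]; split => // A FA; rewrite ZX//.
have mA := sub_sigma_measurable Cm FA.
apply: ae_eq_integral => //.
- by apply/measurable_EFinP; exact: measurable_funTS.
- by apply/measurable_EFinP; exact: measurable_funTS.
- by apply: filterS XY => w -> _.
Qed.

(** The difference of two versions is both centered on the sub-sigma-algebra and
    measurable for it, hence orthogonal to itself. *)
Lemma cond_exp_unique X Z Z' : X \in Lfun P 2%:E ->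
  is_cond_exp P <<s C >> X Z -> is_cond_exp P <<s C >> X Z' ->
  \forall w \ae P, Z w = Z' w.
Proof.
move=> XL ceZ ceZ'.
have [ZL ZL'] := (cond_exp_Lfun2 Cm XL ceZ, cond_exp_Lfun2 Cm XL ceZ').
have DL := Lfun2B ZL ZL'.
have FD B : measurable B -> <<s C >> ((fun w => Z w - Z' w) @^-1` B).
  move: B; apply/g_sigma_funP; apply: measurable_funB.
    by apply/g_sigma_funP; case: ceZ.
  by apply/g_sigma_funP; case: ceZ'.
have D0 : centered P <<s C >> (fun w => Z w - Z' w).
  move=> A FA; have mA := sub_sigma_measurable Cm FA.
  have int (U : T -> R) : U \in Lfun P 2%:E -> P.-integrable A (EFin \o U).
    move=> /Lfun2_sub1/Lfun1_integrable; exact: integrableS.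
  rewrite RintegralB//; [|exact: int|exact: int].
  by case: ceZ ceZ' => [_ _ iZ] [_ _ iZ']; rewrite /Rintegral iZ// iZ'// subrr.
have : \int[P]_w ((Z w - Z' w) ^+ 2) = 0.
  under eq_Rintegral do rewrite expr2.
  by apply: (centered_mul Cm) => //; [exact: Lfun2_sub1|exact: mul_Lfun2].
by move=> /(Rintegral_sqr_eq0 DL); apply: filterS => w /eqP; rewrite subr_eq0 => /eqP.
Qed.

End almost_everywhere.

Lemma sigma_gen_preimage {R : realType} {I S T : Type} (D : set I)
    (X : I -> S -> R) (F : set_system T) (f : T -> S) :
  sigma_algebra setT F ->
  (forall k, D k -> forall B, measurable B -> F ((X k \o f) @^-1` B)) ->
  forall A, sigma_gen D X A -> F (f @^-1` A).
Proof.
move=> [F0 FC FU] FX A /(_ [set B | F (f @^-1` B)]); apply; split; last first.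
  by move=> B [k Dk [B' mB' <-]] /=; rewrite setTI; exact: FX.
split => /=; first by rewrite preimage_set0.
  by move=> B FB; rewrite setTD preimage_setC -setTD; exact: FC.
by move=> B FB; rewrite preimage_bigcup; exact: FU.
Qed.

Lemma sigma_gen_comp {R : realType} {I : Type} {S : pointedType} {T : Type} (D : set I)
    (X : I -> S -> R) (f : T -> S) :
  sigma_gen D (fun k => X k \o f) = [set f @^-1` A | A in sigma_gen D X].
Proof.
rewrite /sigma_gen.
have -> : \bigcup_(k in D) preimage_set_system setT (X k \o f) measurable =
    preimage_set_system setT f (\bigcup_(k in D) preimage_set_system setT (X k) measurable).
  apply/seteqP; split=> [A [k Dk [B mB <-]]|A [_ [k Dk [B mB <-]] <-]].
    exists (X k @^-1` B); rewrite ?setTI//; exists k => //.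
    by exists B; rewrite ?setTI.
  by exists k => //; exists B; rewrite ?setTI.
rewrite g_sigma_preimageE; apply/seteqP; split=> A [B mB <-].
  by exists B; rewrite ?setTI.
by exists B; rewrite ?setTI.
Qed.

Section law.
Context {d d' : measure_display} {T : measurableType d} {S : measurableType d'}
  {R : realType}.
Variables (P : probability T R) (mu : probability S R) (f : T -> S).
Hypothesis mf : measurable_fun setT f.
Hypothesis muE : forall A, measurable A -> mu A = P (f @^-1` A).
Implicit Types (X Z : S -> R).

Lemma law_ge0_integral (D : set S) (X : S -> \bar R) : measurable D ->
  measurable_fun setT X -> (forall x, 0 <= X x)%E ->
  (\int[mu]_(x in D) X x = \int[P]_(w in f @^-1` D) X (f w))%E.
Proof.
move=> mD mX X0; rewrite -(ge0_integral_pushforward mf)//; last exact: measurable_funTS.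
by apply: eq_measure_integral => A mA _; exact: muE.
Qed.

Lemma law_Lfun1 X : measurable_fun setT X ->
  (X \in Lfun mu 1) = (X \o f \in Lfun P 1).
Proof.
move=> mX; have mXf : measurable_fun setT (X \o f) by exact: measurableT_comp.
apply/idP/idP => /Lfun1_integrable/integrableP[_ iX];
  apply/Lfun1_integrable/integrableP; split; try exact/measurable_EFinP.
  by move: iX; rewrite law_ge0_integral//; exact/measurableT_comp/measurable_EFinP.
by rewrite law_ge0_integral//; exact/measurableT_comp/measurable_EFinP.
Qed.

Lemma law_Lfun2 X : measurable_fun setT X ->
  (X \in Lfun mu 2%:E) = (X \o f \in Lfun P 2%:E).
Proof.
move=> mX; have mXf : measurable_fun setT (X \o f) by exact: measurableT_comp.
apply/idP/idP => /Lfun2_integrable_sqr/Lfun1_integrable L1;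
  apply: sqr_Lfun2 => //; apply/Lfun1_integrable.
  by move: L1; rewrite law_Lfun1//; exact: measurable_funX.
by rewrite law_Lfun1//; exact: measurable_funX.
Qed.

Lemma law_Rintegral (D : set S) X : measurable D -> X \in Lfun mu 1 ->
  \int[mu]_(x in D) X x = \int[P]_(w in f @^-1` D) X (f w).
Proof.
move=> mD XL; have mX := Lfun1_measurable XL.
have /Lfun1_integrable iXf : X \o f \in Lfun P 1 by rewrite -law_Lfun1.
rewrite /Rintegral; congr fine.
have := @integral_pushforward _ _ T S R f mf P D (EFin \o X).
move=> /(_ _ _ mD) <-; last 2 first.
- exact/measurable_EFinP.
- apply: (integrableS measurableT) => //.
  by rewrite -[X in measurable X]setTI; exact: mf.
by apply: eq_measure_integral => A mA _; exact: muE.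
Qed.

Lemma law_is_cond_exp {I : Type} (D : set I) (H : I -> S -> R) X Z :
  (forall k, measurable_fun setT (H k)) -> X \in Lfun mu 1 ->
  is_cond_exp mu (sigma_gen D H) X Z ->
  is_cond_exp P (sigma_gen D (fun k => H k \o f)) (X \o f) (Z \o f).
Proof.
move=> mH XL ceZ; have ZL := is_cond_exp_Lfun1 ceZ; have [iZ FZ ZX] := ceZ.
have XL' : X \o f \in Lfun P 1 by rewrite -law_Lfun1//; exact: Lfun1_measurable XL.
have ZL' : Z \o f \in Lfun P 1 by rewrite -law_Lfun1//; exact: Lfun1_measurable ZL.
split.
- exact: (Lfun1_integrable P _).1 ZL'.
- by move=> B mB; rewrite sigma_gen_comp; exists (Z @^-1` B) => //; exact: FZ.
- move=> A; rewrite sigma_gen_comp => -[B FB <-].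
  have mB : measurable B.
    apply: (sub_sigma_measurable _ FB) => C [k _ [B' mB' <-]]; exact: mH.
  have mfB : measurable (f @^-1` B) by rewrite -[X in measurable X]setTI; exact: mf.
  rewrite -(EFin_Rintegral mfB ZL') -(EFin_Rintegral mfB XL').
  by rewrite -!law_Rintegral// /Rintegral ZX.
Qed.

Lemma law_ae_eq0 X : X \in Lfun mu 2%:E -> \int[mu]_x (X x ^+ 2) = 0 ->
  \forall w \ae P, X (f w) = 0.
Proof.
move=> XL X0; have mX := Lfun2_measurable XL; apply: (@Rintegral_sqr_eq0 _ _ _ P (X \o f)).
  by rewrite -law_Lfun2.
rewrite -[LHS](@law_Rintegral setT (fun x => X x ^+ 2))//.
by apply/Lfun1_integrable; exact: Lfun2_integrable_sqr.
Qed.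

(** Projections are functions of the noise that depend only on the joint law of
    the noise and of the variable, by uniqueness of conditional expectations. *)
Lemma law_graph_proj (H : noise_index -> S -> R) X (X' : T -> R) G :
  (forall k, measurable_fun setT (H k)) ->
  X \in Lfun mu 2%:E -> measurable_fun setT X' ->
  (\forall w \ae P, X' w = X (f w)) ->
  \forall w \ae P, graph_proj P (fun k => H k \o f) X' G w = graph_proj mu H X G (f w).
Proof.
move=> mH XL mX' X'E; have mX := Lfun2_measurable XL.
have mXf : measurable_fun setT (X \o f) by exact: measurableT_comp.
have mHf k : measurable_fun setT (H k \o f) by exact: measurableT_comp.
have EX' : \forall w \ae P, X (f w) = X' w by apply: filterS X'E => w ->.
have XL' : X' \in Lfun P 2%:E by apply: ae_Lfun2 EX' _ => //; rewrite -law_Lfun2.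
elim/subgraph_ind: G => G IH.
rewrite !projE.
have : \forall w \ae P, proj_sum P (fun k => H k \o f) X' G w = proj_sum mu H X G (f w).
  have gm := sigma_gen_gens mHf (D := noise_in G).
  apply: (cond_exp_unique gm XL'); first exact/proj_sum_cond_exp/Lfun2_sub1.
  apply: (is_cond_exp_ae gm _ _ EX') => //.
  apply: law_is_cond_exp => //; first exact: Lfun2_sub1.
  exact/proj_sum_cond_exp/Lfun2_sub1.
have : \forall w \ae P,
    \sum_(F <- subgraphs G | F != G) graph_proj P (fun k => H k \o f) X' F w =
    \sum_(F <- subgraphs G | F != G) graph_proj mu H X F (f w).
  by apply: ae_sum => F; rewrite mem_subgraphs; exact: IH.
by apply: filterS2 => w -> ->.
Qed.

End law.

(** * Relabelling the vertices *)

Section relabel.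
Variables (s1 s2 : nat -> nat).
Hypotheses (s1_inj : injective s1) (s2_inj : injective s2).

Definition relabel_noise (k : noise_index) : noise_index :=
  match k with
  | inl (inl i) => inl (inl (s1 i))
  | inl (inr j) => inl (inr (s2 j))
  | inr e => inr (s1 e.1, s2 e.2)
  end.

Lemma relabel_noise_inj : injective relabel_noise.
Proof.
by case=> [[i|j]|[i j]] [[i'|j']|[i' j']] //= []; [move=> /s1_inj ->|
  move=> /s2_inj ->|move=> /s1_inj -> /s2_inj ->].
Qed.

Let s12 (e : nat * nat) := (s1 e.1, s2 e.2).

Let s12_inj : injective s12.
Proof. by move=> [i j] [i' j'] [/s1_inj -> /s2_inj ->]. Qed.

Lemma relabel_subproof (G : bigraph) :
  (s12 @` edges G `<=` (s1 @` V1 G) `*` (s2 @` V2 G))%fset.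
Proof.
apply/fsubsetP => _ /imfsetP[[i j] /= eG ->]; rewrite inE /=.
have := fsubsetP (valP G) _ eG; rewrite inE /= => /andP[iG jG].
by rewrite !in_imfset.
Qed.

Definition relabel (G : bigraph) : bigraph :=
  @Bigraph (_, _, _) (relabel_subproof G).

Lemma mem_imfset_inj (K K' : choiceType) (f : K -> K') (A : {fset K}) x :
  injective f -> (f x \in f @` A)%fset = (x \in A).
Proof.
move=> f_inj; apply/imfsetP/idP => [[y /= yA /f_inj ->]//|xA].
by exists x.
Qed.

Lemma imfset_inj (K K' : choiceType) (f : K -> K') : injective f ->
  injective (fun A : {fset K} => (f @` A)%fset).
Proof.
move=> f_inj A B AB; apply/fsetP => x.
by rewrite -(mem_imfset_inj A x f_inj) AB mem_imfset_inj.
Qed.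

Lemma relabel_inj : injective relabel.
Proof.
move=> F G [e1 e2 e3]; apply: bigraphP.
- exact: (imfset_inj s1_inj e1).
- exact: (imfset_inj s2_inj e2).
- exact: (imfset_inj s12_inj e3).
Qed.

Lemma v1_relabel G : v1 (relabel G) = v1 G.
Proof. by rewrite /v1 [V1 _]/= card_imfset. Qed.

Lemma v2_relabel G : v2 (relabel G) = v2 G.
Proof. by rewrite /v2 [V2 _]/= card_imfset. Qed.

Lemma relabel_empty : relabel empty_graph = empty_graph.
Proof. by apply: bigraphP; rewrite /V1 /V2 /edges /= imfset0. Qed.

Lemma relabel_sub F G : subgraph (relabel F) (relabel G) = subgraph F G.
Proof.
have sub (K K' : choiceType) (f : K -> K') (A B : {fset K}) : injective f ->
    (f @` A `<=` f @` B)%fset = (A `<=` B)%fset.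
  move=> f_inj; apply/fsubsetP/fsubsetP => AB x.
    by rewrite -(mem_imfset_inj A x f_inj) => /AB; rewrite mem_imfset_inj.
  by move=> /imfsetP[y /= /AB yB ->]; rewrite in_imfset.
by rewrite /subgraph /V1 /V2 /edges /= !sub.
Qed.

Lemma sub_relabel F G : subgraph F (relabel G) ->
  exists2 F', subgraph F' G & F = relabel F'.
Proof.
move=> /and3P[/fsubsetP a /fsubsetP b /fsubsetP c].
pose W1 := [fset i in V1 G | s1 i \in V1 F]%fset.
pose W2 := [fset j in V2 G | s2 j \in V2 F]%fset.
pose W := [fset e in edges G | s12 e \in edges F]%fset.
have WW : (W `<=` W1 `*` W2)%fset.
  apply/fsubsetP => -[i j]; rewrite !inE /= => /andP[eG eF].
  have := (fsubsetP (valP F) _ eF, fsubsetP (valP G) _ eG).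
  by rewrite !inE /= => -[/andP[-> ->] /andP[-> ->]].
exists (@Bigraph (W1, W2, W) WW).
  by apply/and3P; split; apply/fsubsetP => x; rewrite /V1 /V2 /edges /= !inE => /andP[].
have im (K K' : choiceType) (f : K -> K') (A : {fset K}) (B : {fset K'}) :
    injective f -> {subset B <= (f @` A)%fset} -> B = (f @` [fset x in A | f x \in B])%fset.
  move=> f_inj BA; apply/fsetP => y; apply/idP/imfsetP => [yB|[x /=]].
    have /imfsetP[x /= xA yx] := BA _ yB.
    by exists x; rewrite //= !inE xA -yx.
  by rewrite !inE => /andP[_ fx] ->.
by apply: bigraphP; rewrite /V1 /V2 /edges /=; apply: im.
Qed.

Lemma noise_in_relabel G : noise_in (relabel G) = relabel_noise @` noise_in G.
Proof.
apply/seteqP; split=> [[[i|j]|e]|_ [[[i|j]|e] kG <-]]; rewrite /= ?in_imfset//.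
- by move=> /imfsetP[k /= kG ->]; exists (inl (inl k)).
- by move=> /imfsetP[k /= kG ->]; exists (inl (inr k)).
- by move=> /imfsetP[k /= kG ->]; exists (inr k).
Qed.

Lemma subgraphs_relabel G :
  perm_eq (subgraphs (relabel G)) (map relabel (subgraphs G)).
Proof.
apply: uniq_perm; rewrite ?fset_uniq ?map_inj_uniq ?fset_uniq//.
  exact: relabel_inj.
move=> F; rewrite mem_subgraphs; apply/idP/mapP => [/sub_relabel[F' F'G ->]|[F' + ->]].
  by exists F'; rewrite ?mem_subgraphs.
by rewrite mem_subgraphs relabel_sub.
Qed.

(** Renaming the noise variables turns the sigma-algebra of [G] into that of its
    relabelling, so the two recursions agree term by term. *)
Lemma graph_proj_relabel d (T : measurableType d) (R : realType)
    (P : probability T R) (H : noise_index -> T -> R) (X : T -> R) G :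
  graph_proj P (H \o relabel_noise) X G = graph_proj P H X (relabel G).
Proof.
elim/subgraph_ind: G => G IH.
have [->|nG] := eqVneq G empty_graph.
  by rewrite relabel_empty !graph_proj_empty.
have nrG : relabel G != empty_graph.
  by apply: contra nG => /eqP e; apply/eqP/relabel_inj; rewrite e relabel_empty.
rewrite !graph_projE//; apply/funext => w; congr (_ - _).
  congr (cond_exp _ <<s _ >> _ _); rewrite noise_in_relabel.
  apply/seteqP; split=> A [k].
    by move=> kG kA; exists (relabel_noise k) => //; exists k.
  by move=> [l lG <-] kA; exists l.
rewrite (perm_big _ (subgraphs_relabel G)) big_map big_seq_cond [RHS]big_seq_cond.
apply: eq_big => [F|F /andP[]]; first by rewrite (inj_eq relabel_inj).
by rewrite mem_subgraphs => FG nFG; rewrite IH.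
Qed.

Lemma relabel_complete i j :
  relabel (complete_graph i j) = complete_graph (s1 @` i)%fset (s2 @` j)%fset.
Proof.
apply: bigraphP => //; apply/fsetP => -[a b]; rewrite /edges /= !inE /=.
apply/imfsetP/andP => [[[x y] /=]|[/imfsetP[x /= xi ->] /imfsetP[y /= yj ->]]].
  by rewrite !inE /= => /andP[xi yj] [-> ->]; rewrite !in_imfset.
by exists (x, y); rewrite //= !inE /= xi.
Qed.

End relabel.

(** * The common law of the noise variables *)

Section noise_space.
Variable R : realType.

(** On this product space the noise variables read through any choice of distinct
    labels have one and the same law; projections for different index sets are
    compared there. *)
Definition noise_space := g_sigma_algebraType (\bigcup_(k in setT)
  preimage_set_system setT (fun x : noise_index -> R => x k) measurable).

Definition noise_coord (k : noise_index) (x : noise_space) : R := x k.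

Lemma measurable_noise_coord k : measurable_fun setT (noise_coord k).
Proof.
move=> _ B mB; rewrite setTI; apply: sub_sigma_algebra; exists k => //.
by exists B; rewrite ?setTI.
Qed.

Section sample.
Context {d : measure_display} {T : measurableType d}.
Variable P : probability T R.
Implicit Types H : noise_index -> T -> R.

Definition sample H (w : T) : noise_space := fun k => H k w.

Lemma measurable_sample H : (forall k, measurable_fun setT (H k)) ->
  measurable_fun setT (sample H).
Proof.
move=> mH _ A mA; rewrite setTI; move: A mA.
apply: (sigma_gen_preimage (D := setT) (X := noise_coord)).
  exact: sigma_algebra_measurable.
by move=> k _ B mB; rewrite -[X in measurable X]setTI; exact: mH.
Qed.

Lemma law_exists d' (S : measurableType d') (f : T -> S) : measurable_fun setT f ->
  exists mu : probability S R, forall A, mu A = P (f @^-1` A).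
Proof.
move=> mf; pose g : {mfun T >-> S} := HB.pack f (isMeasurableFun.Build _ _ _ _ f mf).
by exists (distribution P g).
Qed.

(** Both laws give a cylinder the product of its marginal probabilities, and
    cylinders form a generating pi-system. *)
Lemma sample_law H H' :
  (forall k, measurable_fun setT (H k)) -> (forall k, measurable_fun setT (H' k)) ->
  mutually_independent P H -> mutually_independent P H' ->
  (forall k B, measurable B -> P (H k @^-1` B) = P (H' k @^-1` B)) ->
  forall A, measurable A -> P (sample H @^-1` A) = P (sample H' @^-1` A).
Proof.
move=> mH mH' iH iH' HH' A mA.
have [mu muE] := law_exists (measurable_sample mH).
have [mu' muE'] := law_exists (measurable_sample mH').
rewrite -muE -muE'.
apply: (@measure_unique _ _ _ (cylinder noise_coord setT) (fun=> setT)) => //.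
- exact: sigma_gen_cylinder.
- exact: cylinderI.
- by move=> _; exact: cylinderT.
- by apply/seteqP; split => // x _; exists 0%N.
- move=> A0 [J [B [_ mB A0E]]].
  suff : P (sample H @^-1` A0) = P (sample H' @^-1` A0) by rewrite -muE -muE'.
  have -> : sample H @^-1` A0 = \bigcap_(k in [set` J]) H k @^-1` B k by rewrite A0E.
  have -> : sample H' @^-1` A0 = \bigcap_(k in [set` J]) H' k @^-1` B k by rewrite A0E.
  by rewrite iH// iH'//; apply: eq_bigr => k _; exact: HH'.
- by move=> _; rewrite ltey_eq fin_num_measure.
Qed.

Lemma mutually_independent_inj (I : choiceType) (H : I -> T -> R) (s : I -> I) :
  injective s -> mutually_independent P H -> mutually_independent P (H \o s).
Proof.
move=> s_inj iH J B mB.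
(* [B] carried along the partial inverse of [s] *)
pose B' l := if pselect (exists k, s k = l) is left e then B (projT1 (cid e)) else setT.
have B's k : B' (s k) = B k.
  rewrite /B'; case: pselect => [e|[]]; last by exists k.
  by congr B; apply: s_inj; exact: projT2 (cid e).
have mB' l : measurable (B' l) by rewrite /B'; case: pselect.
have := iH [fset s k | k in J]%fset B' mB'.
rewrite big_imfset/=; last by move=> x y _ _ /s_inj.
under eq_bigr do rewrite B's.
move=> <-; congr (P _); apply/seteqP; split=> w /= wJ.
  by move=> _ /= /imfsetP[k /= kJ ->]; rewrite /preimage /= B's; exact: wJ.
move=> k /= kJ; have := wJ (s k); rewrite /preimage /= B's; apply.
by rewrite in_imfset.
Qed.

End sample.
End noise_space.

(** * The kernel as a function of the noise *)

Lemma mem_seg n a : (a \in seg n) = (a < n)%N.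
Proof. by rewrite /seg !inE mem_iota. Qed.

Lemma card_seg n : #|` seg n| = n.
Proof. by rewrite /seg card_fseq undup_id ?iota_uniq// size_iota. Qed.

(** Only the values enumerating [i] matter; past the end of [i] the values have to
    be new and distinct, so that this is an injective relabelling of all vertices. *)
Definition label (i : {fset nat}) (a : nat) : nat :=
  if (a < #|` i|)%N then nth 0%N (sort leq i) a else ((\max_(x <- i) x).+1 + a)%N.

Lemma label_in i a : (a < #|` i|)%N -> label i a \in i.
Proof.
move=> ai; rewrite /label ai -(mem_sort leq); apply: mem_nth.
by rewrite size_sort.
Qed.

Lemma label_out i a : (#|` i| <= a)%N -> label i a = ((\max_(x <- i) x).+1 + a)%N.
Proof. by rewrite /label ltnNge => ->. Qed.

Lemma label_inj i : injective (label i).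
Proof.
have le_max x : x \in i -> (x <= \max_(y <- i) y)%N.
  by move=> xi; apply: leq_bigmax_seq.
move=> a b; case: (ltnP a #|` i|) => ai; case: (ltnP b #|` i|) => bi.
- by rewrite /label ai bi => /eqP; rewrite nth_uniq ?size_sort ?sort_uniq ?fset_uniq// => /eqP.
- by rewrite (label_out bi) => ab; have := le_max _ (label_in ai); lia.
- by rewrite (label_out ai) => ab; have := le_max _ (label_in bi); lia.
- by rewrite !label_out// => /addnI.
Qed.

Lemma label_image i k : #|` i| = k -> (label i @` seg k)%fset = i.
Proof.
move=> ik; apply/eqP; rewrite eqEfcard card_imfset ?card_seg ?ik ?leqnn ?andbT//=; last first.
  exact: label_inj.
apply/fsubsetP => _ /imfsetP[a /= + ->]; rewrite mem_seg -ik; exact: label_in.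
Qed.

Section kernel.
Context {R : realType}.
Variables (phi : R * R * R -> R) (p q : nat) (h : 'M[R]_(p, q) -> R).
Let cube : set (R * R * R) := `[0%R, 1%R] `*` `[0%R, 1%R] `*` `[0%R, 1%R].
Hypothesis phi_meas : measurable_fun cube phi.
Hypothesis h_meas : forall B : set R, measurable B ->
  sigma_gen setT (fun (k : 'I_p * 'I_q) (M : 'M[R]_(p, q)) => M k.1 k.2) (h @^-1` B).

(** Measurability of [phi] is known on the unit cube only, where the noise lies
    almost surely; hence the extension by 0. *)
Definition kernel_mx (x : noise_space R) : 'M[R]_(p, q) :=
  \matrix_(a < p, b < q) (phi \_ cube)
    (noise_coord (inl (inl (a : nat))) x, noise_coord (inl (inr (b : nat))) x,
     noise_coord (inr (a : nat, b : nat)) x).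

Definition kernel (x : noise_space R) : R := h (kernel_mx x).

Lemma measurable_phi0 : measurable_fun setT (phi \_ cube).
Proof.
apply/(measurable_restrictT _ _).1 => //.
by apply: measurableX; [apply: measurableX|]; exact: measurable_itv.
Qed.

Lemma noise_coord_sigma_gen (D : set noise_index) k : D k -> measurable_fun
  (setT : set (g_sigma_algebraType (\bigcup_(k in D) preimage_set_system setT
     (noise_coord k : noise_space R -> R) measurable))) (noise_coord k).
Proof.
move=> Dk _ B mB; rewrite setTI; apply: sub_sigma_algebra; exists k => //.
by exists B; rewrite ?setTI.
Qed.

Lemma kernel_sigma_gen B : measurable B ->
  sigma_gen (noise_in (complete_graph (seg p) (seg q))) (@noise_coord R) (kernel @^-1` B).
Proof.
move=> mB; rewrite /kernel -[_ @^-1` B]/(kernel_mx @^-1` (h @^-1` B)).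
move: (h @^-1` B) (h_meas mB); apply: sigma_gen_preimage.
  exact: smallest_sigma_algebra.
move=> [a b] _; apply/g_sigma_funP => /=.
rewrite (_ : _ \o kernel_mx = (phi \_ cube) \o (fun x : noise_space R =>
    (noise_coord (inl (inl (a : nat))) x, noise_coord (inl (inr (b : nat))) x,
     noise_coord (inr (a : nat, b : nat)) x))); last first.
  by apply/funext => x; rewrite /= mxE.
apply: measurableT_comp; first exact: measurable_phi0.
apply: measurable_fun_pair; first apply: measurable_fun_pair.
- by apply: noise_coord_sigma_gen; rewrite /= mem_seg.
- by apply: noise_coord_sigma_gen; rewrite /= mem_seg.
- by apply: noise_coord_sigma_gen; rewrite /noise_in /edges /= inE /= !mem_seg !ltn_ord.
Qed.

Lemma measurable_kernel : measurable_fun setT kernel.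
Proof.
have /g_sigma_funP := kernel_sigma_gen; apply: g_sigma_measurable_fun.
exact: (sigma_gen_gens (@measurable_noise_coord R)).
Qed.

End kernel.

Section array.
Context {R : realType} {disp : measure_display} {T : measurableType disp}.
Variables (P : probability T R) (Y : nat -> nat -> {RV P >-> R}).
Variables (xi eta : nat -> {RV P >-> R}) (zeta : nat -> nat -> {RV P >-> R}).
Hypothesis xi_unif : forall i, uniform01 (xi i).
Hypothesis eta_unif : forall j, uniform01 (eta j).
Hypothesis zeta_unif : forall i j, uniform01 (zeta i j).
Local Notation H := (noise xi eta zeta).
Hypothesis noise_indep : mutually_independent P H.
Variable phi : R * R * R -> R.
Hypothesis phi_meas : measurable_fun
  (`[0%R, 1%R] `*` `[0%R, 1%R] `*` `[0%R, 1%R] : set (R * R * R)) phi.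
Hypothesis Y_repr : forall i j,
  \forall w \ae P, Y i j w = phi (xi i w, eta j w, zeta i j w).
Variables (p q : nat) (h : 'M[R]_(p, q) -> R).
Hypothesis h_meas : forall B : set R, measurable B ->
  sigma_gen setT (fun (k : 'I_p * 'I_q) (M : 'M[R]_(p, q)) => M k.1 k.2) (h @^-1` B).
Hypothesis h_L2 : forall i j : {fset nat}, #|` i| = p -> #|` j| = q ->
  ('E_P[fun w => (hval h Y i j w ^+ 2)%R] < +oo)%E.

Lemma measurable_noise k : measurable_fun setT (H k).
Proof. by case: k => [[i|j]|[i j]] /=. Qed.

Lemma uniform01_ae (X : {RV P >-> R}) : uniform01 X ->
  \forall w \ae P, (X w \in `[0, 1]).
Proof.
move=> uX; exists (X @^-1` (~` `[0, 1]%classic)); split.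
- by rewrite -[X in measurable X]setTI; apply: measurable_funP => //; apply: measurableC.
- have := uX (~` `[0, 1]%classic) (measurableC (measurable_itv _)).
  rewrite /distribution/= /pushforward => ->.
  by rewrite /uniform_prob integral_uniform_pdf setICl integral_set0.
- by move=> w /= /negP; rewrite /= => nX /=; exact/negP.
Qed.

Lemma array_ae i j : \forall w \ae P, Y i j w =
  (phi \_ (`[0%R, 1%R] `*` `[0%R, 1%R] `*` `[0%R, 1%R])) (xi i w, eta j w, zeta i j w).
Proof.
have : \forall w \ae P, zeta i j w \in `[0, 1] /\
    Y i j w = phi (xi i w, eta j w, zeta i j w).
  by apply: filterS2 (uniform01_ae (zeta_unif i j)) (Y_repr i j).
have := uniform01_ae (eta_unif j).
have := uniform01_ae (xi_unif i).
apply: filterS3 => w x01 y01 [z01 ->]; by rewrite patchE mem_set.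
Qed.

Lemma noise_marginal k B : measurable B -> P (H k @^-1` B) = uniform_prob ltr01 B.
Proof.
move=> mB; case: k => [[i|j]|[i j]] /=.
- by rewrite -(xi_unif i mB).
- by rewrite -(eta_unif j mB).
- by rewrite -(zeta_unif i j mB).
Qed.

Lemma measurable_hval i j : measurable_fun setT (hval h Y i j).
Proof.
move=> _ B mB; rewrite setTI.
pose M w : 'M[R]_(p, q) := \matrix_(a < p, b < q)
  Y (nth 0%N (sort leq i) a) (nth 0%N (sort leq j) b) w.
rewrite -[_ @^-1` _]/(M @^-1` (h @^-1` B)); move: (h @^-1` B) (h_meas mB).
apply: sigma_gen_preimage; first exact: sigma_algebra_measurable.
move=> [a b] _ B' mB' /=.
rewrite (_ : _ \o _ = Y (nth 0%N (sort leq i) a) (nth 0%N (sort leq j) b)); last first.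
  by apply/funext => w; rewrite /= mxE.
by rewrite -[X in measurable X]setTI; exact: measurable_funP.
Qed.

Lemma hval_Lfun2 i j : #|` i| = p -> #|` j| = q -> hval h Y i j \in Lfun P 2%:E.
Proof.
move=> ip jq; have mh := measurable_hval i j; apply: sqr_Lfun2 => //.
apply/integrableP; split; first by apply/measurable_EFinP; exact: measurable_funX.
have := h_L2 ip jq; rewrite unlock; apply: le_lt_trans; rewrite le_eqVlt; apply/orP; left.
by apply/eqP; apply: eq_integral => w _; rewrite gee0_abs ?lee_fin ?sqr_ge0.
Qed.

Definition label_noise i j w : noise_space R :=
  sample (H \o relabel_noise (label i) (label j)) w.

Lemma measurable_label_noise i j : measurable_fun setT (label_noise i j).
Proof. by apply: measurable_sample => k; exact: measurable_noise. Qed.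

Lemma hval_kernel i j : #|` i| = p -> #|` j| = q ->
  \forall w \ae P, hval h Y i j w = kernel phi h (label_noise i j w).
Proof.
move=> ip jq.
have : \forall w \ae P, forall (a : 'I_p) (b : 'I_q),
    Y (label i a) (label j b) w =
  (phi \_ (`[0%R, 1%R] `*` `[0%R, 1%R] `*` `[0%R, 1%R]))
    (xi (label i a) w, eta (label j b) w, zeta (label i a) (label j b) w).
  by do 2 apply: filter_forall => ?; exact: array_ae.
apply: filterS => w YE; rewrite /hval /kernel; congr h.
apply/matrixP => a b; rewrite !mxE -YE.
by rewrite /label ip jq !ltn_ord.
Qed.

Section common_law.
Variable mu : probability (noise_space R) R.
Hypothesis muE : forall A, mu A = P (sample H @^-1` A).

Lemma label_noise_law i j A : measurable A -> mu A = P (label_noise i j @^-1` A).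
Proof.
move=> mA; rewrite muE; apply: sample_law => //.
- exact: measurable_noise.
- by move=> k; exact: measurable_noise.
- apply: mutually_independent_inj => //.
  by apply: relabel_noise_inj; exact: label_inj.
- by move=> k B mB; rewrite /= !noise_marginal.
Qed.

Lemma kernel_Lfun2 : kernel phi h \in Lfun mu 2%:E.
Proof.
have mk := measurable_kernel phi_meas h_meas.
rewrite (law_Lfun2 (measurable_label_noise (seg p) (seg q))
  (@label_noise_law (seg p) (seg q)) mk).
apply: ae_Lfun2 (hval_kernel (card_seg p) (card_seg q)) _.
- by apply: measurableT_comp => //; exact: measurable_label_noise.
- by apply: hval_Lfun2; exact: card_seg.
Qed.

Lemma hval_moment i j k : (0 < k <= 2)%N -> #|` i| = p -> #|` j| = q ->
  \int[P]_w (hval h Y i j w ^+ k) = \int[mu]_x (kernel phi h x ^+ k).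
Proof.
move=> k12 ip jq; have mk := measurable_kernel phi_meas h_meas.
rewrite (law_Rintegral (measurable_label_noise i j) (@label_noise_law i j)
  measurableT (X := fun x => kernel phi h x ^+ k)); last first.
  case: k k12 => [|[|[|]]]// _; first exact/Lfun2_sub1/kernel_Lfun2.
  by apply/Lfun1_integrable/Lfun2_integrable_sqr/kernel_Lfun2.
apply: ae_Rintegral => //.
- by apply: measurable_funX; exact: measurable_hval.
- apply: measurable_funX; apply: measurableT_comp => //; exact: measurable_label_noise.
- by apply: filterS (hval_kernel ip jq) => w ->.
Qed.

Local Notation proj := (graph_proj P H).

Lemma proj_law i j G : #|` i| = p -> #|` j| = q ->
  \forall w \ae P, proj (hval h Y i j) (relabel (label i) (label j) G) w =
    graph_proj mu (@noise_coord R) (kernel phi h) G (label_noise i j w).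
Proof.
move=> ip jq; rewrite -graph_proj_relabel; [|exact: label_inj|exact: label_inj].
rewrite (_ : H \o _ = (fun k => noise_coord k \o label_noise i j))//.
exact: (law_graph_proj (measurable_label_noise i j) (@label_noise_law i j) G
  (@measurable_noise_coord R) kernel_Lfun2 (measurable_hval i j) (hval_kernel ip jq)).
Qed.

Lemma relabel_label_complete i j : #|` i| = p -> #|` j| = q ->
  relabel (label i) (label j) (complete_graph (seg p) (seg q)) = complete_graph i j.
Proof.
by move=> ip jq; rewrite relabel_complete ?label_image//; exact: label_inj.
Qed.

Lemma sub_complete i j F : #|` i| = p -> #|` j| = q -> subgraph F (complete_graph i j) ->
  exists2 G, subgraph G (complete_graph (seg p) (seg q)) &
             F = relabel (label i) (label j) G.
Proof.
move=> ip jq; rewrite -(relabel_label_complete ip jq) => /sub_relabel.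
by apply; exact: label_inj.
Qed.

Lemma sigma_gen_self d' (S : measurableType d') (Q : probability S R) (C : set_system S) X :
  X \in Lfun Q 1 -> (forall B, measurable B -> <<s C >> (X @^-1` B)) ->
  is_cond_exp Q <<s C >> X X.
Proof. by move=> /Lfun1_integrable iX FX; split. Qed.

(** [F] is a relabelling of a subgraph [G] of the complete graph on [seg p] and
    [seg q]. Under any labels, the projection on the relabelled [G] has the second
    moment of the projection of [kernel phi h] on [G] under the common law [mu], so
    it vanishes for the labels [i], [j] as it does for those of [seg p], [seg q]. *)
Lemma proj_null i j F : #|` i| = p -> #|` j| = q -> subgraph F (complete_graph i j) ->
  (forall G, subgraph G (complete_graph (seg p) (seg q)) -> v1 G = v1 F -> v2 G = v2 F ->
     \forall w \ae P, proj (hval h Y (seg p) (seg q)) G w = 0) ->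
  \forall w \ae P, proj (hval h Y i j) F w = 0.
Proof.
move=> ip jq /(sub_complete ip jq)[G GK ->] null.
set G0 := relabel (label (seg p)) (label (seg q)) G.
have qL : graph_proj mu (@noise_coord R) (kernel phi h) G \in Lfun mu 2%:E.
  exact: (proj_Lfun2 (@measurable_noise_coord R) kernel_Lfun2).
have lab := measurable_label_noise.
have q0 : \int[mu]_x (graph_proj mu (@noise_coord R) (kernel phi h) G x ^+ 2) = 0.
  have qm := Lfun2_measurable qL.
  rewrite (law_Rintegral (lab (seg p) (seg q)) (@label_noise_law (seg p) (seg q))
    measurableT (X := fun x => graph_proj mu (@noise_coord R) (kernel phi h) G x ^+ 2)); last first.
    by apply/Lfun1_integrable/Lfun2_integrable_sqr.
  have G0K : subgraph G0 (complete_graph (seg p) (seg q)).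
    rewrite -(relabel_label_complete (card_seg p) (card_seg q)) relabel_sub//;
      exact: label_inj.
  have q0 : \forall w \ae P,
      graph_proj mu (@noise_coord R) (kernel phi h) G (label_noise (seg p) (seg q) w) ^+ 2 = 0.
    apply: filterS2 (proj_law G (card_seg p) (card_seg q)) (null G0 G0K _ _).
    - by move=> w <- ->; rewrite expr0n.
    - by rewrite !v1_relabel//; exact: label_inj.
    - by rewrite !v2_relabel//; exact: label_inj.
  rewrite preimage_setT (ae_Rintegral (Y := cst 0) _ _ _ q0)//.
    by rewrite Rintegral_cst// mul0r.
  by apply: measurable_funX; apply: measurableT_comp => //; exact: lab.
have : \forall w \ae P, graph_proj mu (@noise_coord R) (kernel phi h) G (label_noise i j w) = 0.
  exact: (law_ae_eq0 (lab i j) (@label_noise_law i j) qL q0).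
by apply: filterS2 (proj_law G ip jq) => w ->.
Qed.

(** The kernel is a function of the noise of the complete graph, hence equal to
    its conditional expectation given that noise. *)
Lemma kernel_decomposition : \forall x \ae mu,
  kernel phi h x = proj_sum mu (@noise_coord R) (kernel phi h) (complete_graph (seg p) (seg q)) x.
Proof.
have gm := sigma_gen_gens (@measurable_noise_coord R).
apply: (cond_exp_unique (gm _) kernel_Lfun2).
  apply: sigma_gen_self; first exact/Lfun2_sub1/kernel_Lfun2.
  exact: kernel_sigma_gen.
apply: proj_sum_cond_exp; first exact: measurable_noise_coord.
exact/Lfun2_sub1/kernel_Lfun2.
Qed.

Lemma hval_sum_proj_common i j : #|` i| = p -> #|` j| = q ->
  \forall w \ae P, hval h Y i j w = proj_sum P H (hval h Y i j) (complete_graph i j) w.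
Proof.
move=> ip jq.
have [kL hk] := (kernel_Lfun2, hval_kernel ip jq).
have lm := measurable_label_noise i j.
set K := complete_graph (seg p) (seg q).
have S0 : \forall w \ae P, kernel phi h (label_noise i j w) -
    proj_sum mu (@noise_coord R) (kernel phi h) K (label_noise i j w) = 0.
  have sL := proj_sum_Lfun2 (@measurable_noise_coord R) kL K.
  apply: (law_ae_eq0 lm (@label_noise_law i j) (Lfun2B kL sL)).
  rewrite (ae_Rintegral (Y := cst 0))//.
  - by rewrite Rintegral_cst// mul0r.
  - by apply: measurable_funX; apply: measurable_funB; [exact: Lfun2_measurable kL|exact: Lfun2_measurable sL].
  - by apply: filterS kernel_decomposition => x ->; rewrite subrr expr0n.
have Sl : \forall w \ae P,
    \sum_(G <- subgraphs K) proj (hval h Y i j) (relabel (label i) (label j) G) w =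
    proj_sum mu (@noise_coord R) (kernel phi h) K (label_noise i j w).
  by apply: ae_sum => G _ _; exact: proj_law.
apply: filterS3 hk S0 Sl => w -> /eqP; rewrite subr_eq0 => /eqP -> <-.
rewrite /proj_sum -(relabel_label_complete ip jq).
rewrite (perm_big _ (subgraphs_relabel (@label_inj i) (@label_inj j) K))/=.
by rewrite big_map.
Qed.

End common_law.

Lemma noise_law_exists : exists mu : probability (noise_space R) R,
  forall A, mu A = P (sample H @^-1` A).
Proof. by apply: law_exists; apply: measurable_sample; exact: measurable_noise. Qed.

Lemma hval_sum_proj i j : #|` i| = p -> #|` j| = q ->
  \forall w \ae P, hval h Y i j w = proj_sum P H (hval h Y i j) (complete_graph i j) w.
Proof. by have [mu muE] := noise_law_exists; exact: hval_sum_proj_common muE i j. Qed.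

End array.

(** * Convergence in law and vanishing perturbations *)

Section slutsky.
Context {R : realType}.

(** Heine's theorem, from compactness of the segment as a near-covering property:
    the modulus [delta] found near each point is uniform over the segment. *)
Lemma unif_continuous_segment (f : R -> R) (K e : R) : continuous f -> 0 < e ->
  exists2 delta, 0 < delta & forall x y, `|x| <= K -> `|x - y| <= delta ->
    `|f x - f y| <= e.
Proof.
move=> cf e0.
have /compact_near_coveringP/(_ R (0^'+)
  (fun delta x => forall y, `|x - y| <= delta -> `|f x - f y| <= e)) :=
  @segment_compact R (- K) K.
case.
  move=> x _.
  have /cvgrPdist_le/(_ (e / 2)) := cf x; rewrite divr_gt0// => /(_ isT).
  move=> /nbhs_ballP[r /= r0 rf].
  exists ([set z | `|x - z| < r / 2], [set delta | delta < r / 2]).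
    split => /=.
      by apply/nbhs_ballP; exists (r / 2); rewrite /= ?divr_gt0.
    by apply: nbhs_right_lt; rewrite divr_gt0.
  move=> [z delta] /= [xz dr] y zy.
  have fz : `|f x - f z| <= e / 2.
    by apply: rf; rewrite /ball/= (lt_le_trans xz)//; lra.
  have fy : `|f x - f y| <= e / 2.
    apply: rf; rewrite /ball/= -(subrKA z) (le_lt_trans (ler_normD _ _))//.
    by rewrite [ltRHS]splitr ltr_leD// (le_trans zy)// ltW.
  rewrite -(subrKA (f x)) (le_trans (ler_normD _ _))// [leRHS]splitr lerD//.
  by rewrite distrC.
move=> r /= r0 rf; exists (r / 2); first by rewrite divr_gt0.
move=> x y xK; apply: (rf (r / 2)) => /=.
- by rewrite sub0r normrN gtr0_norm ?divr_gt0// ltr_pdivrMr// ltr_pMr// ltr1n.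
- by rewrite divr_gt0.
- by rewrite in_itv/= -ler_norml.
Qed.

(** A continuous substitute for the indicator of large values, so that the
    tightness of a sequence can be read off integrals of bounded continuous
    functions of it. *)
Definition cutoff (K x : R) : R := Num.min 1 (Num.max 0 (`|x| - K)).

Lemma cutoff_ge0 K x : 0 <= cutoff K x.
Proof. by rewrite /cutoff le_min ler01 le_max lexx. Qed.

Lemma cutoff_le1 K x : cutoff K x <= 1.
Proof. by rewrite /cutoff ge_min lexx. Qed.

Lemma cutoff1 K x : K + 1 <= `|x| -> cutoff K x = 1.
Proof.
move=> Kx; rewrite /cutoff; apply/min_idPl; rewrite le_max; apply/orP; right.
by rewrite lerBrDl.
Qed.

Lemma cutoff0 K x : `|x| <= K -> cutoff K x = 0.
Proof.
move=> xK; rewrite /cutoff (max_idPl _) ?subr_le0//.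
by apply/min_idPr; rewrite ler01.
Qed.

Lemma continuous_cutoff K : continuous (cutoff K).
Proof.
move=> x; apply: (@continuous_min R R (cst 1) (fun x => Num.max 0 (`|x| - K))).
  exact: cvg_cst.
apply: (@continuous_max R R (cst 0) (fun x => `|x| - K)); first exact: cvg_cst.
apply: cvgB; last exact: cvg_cst.
exact: norm_continuous.
Qed.

Section bounded.
Context {d : measure_display} {T : measurableType d}.
Variable P : probability T R.
Implicit Types (Z : T -> R) (f : R -> R).

Lemma bounded_Lfun1 Z f M : measurable_fun setT Z -> continuous f ->
  (forall x, `|f x| <= M) -> (fun w => f (Z w)) \in Lfun P 1.
Proof.
move=> mZ cf fM; apply/Lfun1_integrable; apply: measurable_bounded_integrable => //.
- by rewrite ltey_eq fin_num_measure.
- by apply: (measurableT_comp _ mZ); exact: continuous_measurable_fun.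
- exists M; split; first exact: num_real.
  by move=> M' /ltW MM' w _; rewrite /= (le_trans (fM _)).
Qed.

Lemma expectation_EFin Z : Z \in Lfun P 1 -> ('E_P[Z])%E = (\int[P]_w Z w)%:E.
Proof. by move=> ZL; rewrite unlock -EFin_Rintegral. Qed.

Lemma cutoff_cvg0 Z : measurable_fun setT Z ->
  \int[P]_w cutoff n%:R (Z w) @[n --> \oo] --> 0.
Proof.
move=> mZ.
have cL n : (fun w => cutoff n%:R (Z w)) \in Lfun P 1.
  apply: (@bounded_Lfun1 Z (cutoff n%:R) 1) => //; first exact: continuous_cutoff.
  by move=> x; rewrite ger0_norm ?cutoff_ge0 ?cutoff_le1.
have [|||||_ _] := @dominated_convergence _ _ _ P setT measurableT
  (fun n w => (cutoff n%:R (Z w))%:E) (cst 0%E) (cst 1%E).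
- by move=> n; apply/measurable_EFinP; exact: Lfun1_measurable (cL n).
- exact: measurable_cst.
- apply: aeW => w _; apply: cvg_near_cst.
  near=> n; rewrite cutoff0//.
  near: n; exact: nbhs_infty_ger.
- exact: finite_measure_integrable_cst.
- by apply: aeW => w n _; rewrite abse_EFin lee_fin ger0_norm ?cutoff_ge0 ?cutoff_le1.
rewrite integral0 => /fine_cvg; apply: cvg_trans.
by apply: near_eq_cvg; apply: nearW => n; rewrite /Rintegral.
Unshelve. all: by end_near. Qed.

End bounded.

Context {d d' : measure_display} {T : measurableType d} {T' : measurableType d'}.
Variables (P : probability T R) (Q : probability T' R) (W : T' -> R).
Hypothesis mW : measurable_fun setT W.

(** A bounded continuous function [f] is uniformly continuous where
    [cutoff K] is less than 1, which dominates [f (X N) - f (X' N)] by a small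
    constant, a multiple of [cutoff K (X' N)], and a multiple of [(X N - X' N)^2]. *)
Lemma cvg_in_law_perturb (X X' : nat -> T -> R) :
  (forall N, measurable_fun setT (X N)) -> (forall N, measurable_fun setT (X' N)) ->
  (\forall N \near \oo, (fun w => X N w - X' N w) \in Lfun P 2%:E) ->
  \int[P]_w ((X N w - X' N w) ^+ 2) @[N --> \oo] --> 0 ->
  cvg_in_law P X' Q W -> cvg_in_law P X Q W.
Proof.
move=> mX mX' DL D0 cvgX' f cf [M fM].
have M0 : 0 <= M by apply: le_trans (fM 0).
have fL N := bounded_Lfun1 P (mX N) cf fM.
have fL' N := bounded_Lfun1 P (mX' N) cf fM.
have fLW := bounded_Lfun1 Q mW cf fM.
have real (Z : nat -> T -> R) (g : R -> R) : (forall N, (fun w => g (Z N w)) \in Lfun P 1) ->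
    (fun w => g (W w)) \in Lfun Q 1 ->
    ('E_P[g \o Z N] @[N --> \oo] --> 'E_Q[g \o W])%E <->
    \int[P]_w g (Z N w) @[N --> \oo] --> \int[Q]_w g (W w).
  move=> gZ gW; rewrite expectation_EFin//.
  under eq_fun do rewrite (expectation_EFin (gZ _)).
  by split=> [/fine_cvg//|?]; apply: cvg_EFin => //; exact: nearW.
apply/real => //.
have {}cvgf : \int[P]_w f (X' N w) @[N --> \oo] --> \int[Q]_w f (W w).
  by apply/real => //; apply: cvgX' => //; exists M.
apply/cvgrPdist_le => e e0.
have [K0 K0e] : exists n : nat, 2 * M * \int[Q]_w cutoff n%:R (W w) <= e / 8.
  have : 2 * M * \int[Q]_w cutoff n%:R (W w) @[n --> \oo] --> 0.
    by rewrite -(mulr0 (2 * M)); apply: cvgM; [exact: cvg_cst|exact: cutoff_cvg0].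
  move=> /cvgrPdist_le/(_ (e / 8)); rewrite divr_gt0// => /(_ isT)[n _ /(_ n (leqnn n))] /=.
  rewrite sub0r normrN => ne; exists n; apply: le_trans ne; exact: ler_norm.
pose K : R := K0%:R.
have cutL N : (fun w => cutoff K (X' N w)) \in Lfun P 1.
  apply: (@bounded_Lfun1 _ _ P (X' N) (cutoff K) 1) => //; first exact: continuous_cutoff.
  by move=> x; rewrite ger0_norm ?cutoff_ge0 ?cutoff_le1.
have cutLW : (fun w => cutoff K (W w)) \in Lfun Q 1.
  apply: (@bounded_Lfun1 _ _ Q W (cutoff K) 1) => //; first exact: continuous_cutoff.
  by move=> x; rewrite ger0_norm ?cutoff_ge0 ?cutoff_le1.
have cvgcut : 2 * M * \int[P]_w cutoff K (X' N w) @[N --> \oo] -->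
    2 * M * \int[Q]_w cutoff K (W w).
  apply: cvgM; first exact: cvg_cst.
  apply/real => //; apply: cvgX'; first exact: continuous_cutoff.
  by exists 1 => x; rewrite ger0_norm ?cutoff_ge0 ?cutoff_le1.
have [delta delta0 fdelta] : exists2 delta, 0 < delta & forall x y, `|x| <= K + 1 ->
    `|x - y| <= delta -> `|f x - f y| <= e / 8.
  by apply: unif_continuous_segment => //; rewrite divr_gt0.
have D0' : 2 * M / delta ^+ 2 * \int[P]_w ((X N w - X' N w) ^+ 2) @[N --> \oo] --> 0.
  by rewrite -(mulr0 (2 * M / delta ^+ 2)); apply: cvgM; first exact: cvg_cst.
(* [x'] within the cut-off and close to [x]; [x'] beyond it; [x] far from [x'] *)
have bound x x' : `|f x - f x'| <= e / 8 + 2 * M * cutoff K x' +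
    2 * M / delta ^+ 2 * (x - x') ^+ 2.
  have c0 := cutoff_ge0 K x'.
  have t1 : 0 <= 2 * M * cutoff K x' by rewrite !mulr_ge0.
  have t2 : 0 <= 2 * M / delta ^+ 2 * (x - x') ^+ 2.
    apply: mulr_ge0 (sqr_ge0 _); apply: divr_ge0 (sqr_ge0 _); exact: mulr_ge0.
  have f2 : `|f x - f x'| <= 2 * M.
    by rewrite (le_trans (ler_normB _ _))//; have := fM x; have := fM x'; lra.
  have [xd|xd] := lerP `|x' - x| delta.
    have [xK|/ltW xK] := lerP `|x'| (K + 1).
      by rewrite distrC; have := fdelta _ _ xK xd; lra.
    by rewrite cutoff1//; rewrite cutoff1// in t1; lra.
  suff : 2 * M <= 2 * M / delta ^+ 2 * (x - x') ^+ 2 by lra.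
  rewrite mulrAC -mulrA ler_peMr ?mulr_ge0//.
  rewrite ler_pdivlMr ?exprn_gt0// mul1r -[leRHS]real_normK ?num_real// distrC.
  by rewrite lerXn2r ?nnegrE// ltW.
(* five error terms, each at most [e / 8] *)
near=> N.
have DLN : (fun w => X N w - X' N w) \in Lfun P 2%:E by near: N.
have D2N := Lfun2_integrable_sqr DLN.
have ab : `|\int[P]_w f (X' N w) - \int[P]_w f (X N w)| <=
    e / 8 + 2 * M * \int[P]_w cutoff K (X' N w) +
    2 * M / delta ^+ 2 * \int[P]_w ((X N w - X' N w) ^+ 2).
  have i1 := (Lfun1_integrable P _).1 (fL N).
  have i2 := (Lfun1_integrable P _).1 (fL' N).
  have i3 := (Lfun1_integrable P _).1 (cutL N).
  have i12 := integrableB measurableT i1 i2.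
  rewrite distrC -RintegralB// (le_trans (le_normr_Rintegral _ _))//.
  rewrite -!RintegralZl// -[e / 8]mulr1.
  have -> : (e / 8 * 1 = \int[P]_w (e / 8))%R.
    by rewrite Rintegral_cst// [X in _ * fine X](probability_setT P).
  have i4 : P.-integrable setT (EFin \o (fun w => e / 8 + 2 * M * cutoff K (X' N w))).
    have ic : P.-integrable setT (EFin \o cst (e / 8)).
      exact: finite_measure_integrable_cst.
    exact: (integrableD measurableT ic (integrableZl measurableT (2 * M) i3)).
  have i5 : P.-integrable setT (EFin \o (fun w => 2 * M / delta ^+ 2 * (X N w - X' N w) ^+ 2)).
    exact: (integrableZl measurableT _ D2N).
  rewrite -!RintegralD//; last 2 first.
  - exact: finite_measure_integrable_cst.
  - exact: (integrableZl measurableT _ i3).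
  apply: le_Rintegral => //.
  - exact: integrable_norm.
  - exact: (integrableD measurableT i4 i5).
rewrite -(subrKA (\int[P]_w f (X' N w))) (le_trans (ler_normD _ _))//.
have b1 : `|\int[Q]_w f (W w) - \int[P]_w f (X' N w)| <= e / 8.
  by near: N; move/cvgrPdist_le: cvgf; apply; rewrite divr_gt0.
have b2 : `|2 * M * \int[Q]_w cutoff K (W w) - 2 * M * \int[P]_w cutoff K (X' N w)| <= e / 8.
  by near: N; move/cvgrPdist_le: cvgcut; apply; rewrite divr_gt0.
have b3 : `|0 - 2 * M / delta ^+ 2 * \int[P]_w ((X N w - X' N w) ^+ 2)| <= e / 8.
  by near: N; move/cvgrPdist_le: D0'; apply; rewrite divr_gt0.
move: b2 b3; rewrite !ler_norml => /andP[b2 _] /andP[b3 _].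
rewrite -/K in K0e.
move: b1 ab b2 b3 K0e; lra.
Unshelve. all: by end_near. Qed.

End slutsky.

(** * Counting subsets *)

Lemma mem_ksubsets k m (B : {fset nat}) :
  (B \in ksubsets k (seg m)) = (B `<=` seg m)%fset && (#|` B| == k).
Proof. by rewrite /ksubsets !inE /= fpowersetE. Qed.

Lemma size_ksubsets k m : size (ksubsets k (seg m)) = 'C(m, k).
Proof.
pose f (A : {set 'I_m}) : {fset nat} := [fset val x | x in A]%fset.
have mf A (x : 'I_m) : (val x \in f A) = (x \in A).
  apply/imfsetP/idP => [[y /= yA /val_inj ->]//|xA]; by exists x.
have f_inj : injective f.
  by move=> A B AB; apply/setP => x; rewrite -!mf AB.
have -> : 'C(m, k) = size (map f (enum [set A : {set 'I_m} | #|A| == k]%SET)).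
  by have := card_draws 'I_m k; rewrite card_ord size_map -cardE => <-.
apply: perm_size; apply: uniq_perm.
- exact: fset_uniq.
- by rewrite map_inj_uniq// enum_uniq.
move=> B; rewrite mem_ksubsets; apply/idP/mapP => [/andP[/fsubsetP Bm /eqP Bk]|[A]].
  exists [set x | val x \in B]%SET.
    rewrite mem_enum inE -Bk; apply/eqP.
    rewrite [X in #|` X|](_ : B = f [set x | val x \in B]%SET); last first.
      apply/fsetP => x; apply/idP/imfsetP => [xB|[y /=]].
        have := Bm _ xB; rewrite mem_seg => xm.
        by exists (Ordinal xm); rewrite //= inE.
      by rewrite inE => yB ->.
    rewrite /f card_imfset; last exact: val_inj.
    by rewrite cardE.
  apply/fsetP => x; apply/idP/imfsetP => [xB|[y /=]].
    have := Bm _ xB; rewrite mem_seg => xm.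
    by exists (Ordinal xm); rewrite //= inE.
  by rewrite inE => yB ->.
rewrite mem_enum inE => /eqP Ak ->; apply/andP; split.
  by apply/fsubsetP => _ /imfsetP[x /= _ ->]; rewrite mem_seg.
by rewrite /f card_imfset ?cardE -?Ak ?cardE//; exact: val_inj.
Qed.

Lemma bin_le_exp m k : ('C(m, k) <= m ^ k)%N.
Proof.
have ff : (m ^_ k <= m ^ k)%N.
  elim: k => // k IH; rewrite ffactnSr expnSr; apply: leq_mul => //; exact: leq_subr.
apply: leq_trans ff; rewrite -bin_ffact; exact/leq_pmulr/fact_gt0.
Qed.

(** A superset [B] of [V] is determined by [B `\` V]. *)
Lemma count_superset k m (V : {fset nat}) : (#|` V| <= k)%N ->
  (count (fun B => V `<=` B)%fset (ksubsets k (seg m)) <= m ^ (k - #|` V|))%N.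
Proof.
move=> Vk; apply: leq_trans (bin_le_exp _ _); rewrite -(size_ksubsets _ m).
rewrite -size_filter -(size_map (fun B => B `\` V)%fset).
apply: uniq_leq_size.
  rewrite map_inj_in_uniq ?filter_uniq ?fset_uniq// => B B'.
  rewrite !mem_filter => /andP[VB _] /andP[VB' _] BB'.
  have split C : (V `<=` C)%fset -> C = (V `|` C `\` V)%fset.
    move=> /fsubsetP VC; apply/fsetP => x; rewrite !inE.
    by case: (boolP (x \in V)) => //= /VC.
  by rewrite (split B)// (split B')// BB'.
move=> _ /mapP[B + ->]; rewrite mem_filter !mem_ksubsets => /and3P[VB Bm /eqP Bk].
by rewrite (fsubset_trans (fsubsetDl _ _) Bm) cardfsDS// Bk eqxx.
Qed.

(** Each of the [k] factors of the falling factorial of [m] is at least [m / 2]. *)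
Lemma bin_ge_exp m k : (2 * k <= m)%N -> (m ^ k <= 2 ^ k * k`! * 'C(m, k))%N.
Proof.
move=> km; rewrite -mulnA [(_`! * _)%N]mulnC bin_ffact.
elim: k km => // k IH km.
rewrite ffactnSr !expnS [(m * _)%N]mulnC.
have /leq_mul : (m ^ k <= 2 ^ k * m ^_ k)%N by apply: IH; lia.
move=> /(_ m (2 * (m - k)))%N H; apply: leq_trans (H _) _; first by lia.
by rewrite !mulnA leq_eqVlt; apply/orP; left; apply/eqP; lia.
Qed.

(** * Second moment of a sum of graph projections *)

Section orthogonal_sum.
Context {d : measure_display} {T : measurableType d} {R : realType}.
Variable P : probability T R.

(** If members of different classes of [key] are orthogonal, only pairs within
    a class contribute to the second moment of a sum. *)
Lemma Rintegral_sqr_sum_le (I K : eqType) (s : seq I) (key : I -> K)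
    (f : I -> T -> R) (M : R) (L : nat) :
  (forall a, a \in s -> f a \in Lfun P 2%:E) ->
  (forall a, a \in s -> \int[P]_w (f a w ^+ 2) <= M) ->
  (forall a b, a \in s -> b \in s -> key a != key b -> \int[P]_w (f a w * f b w) = 0) ->
  (forall a, a \in s -> (count (fun b => key b == key a) s <= L)%N) ->
  \int[P]_w ((\sum_(a <- s) f a w) ^+ 2) <= (size s)%:R * L%:R * M.
Proof.
move=> fL fM orth cL.
have sL : (fun w => \sum_(a <- s) f a w) \in Lfun P 2%:E.
  by apply: Lfun2_sum => a sa _; exact: fL.
under eq_Rintegral do rewrite expr2.
rewrite Rintegral_sum_mul//; last by move=> a sa _; exact: fL.
rewrite -mulrA.
apply: (@le_trans _ _ (\sum_(a <- s) L%:R * M)); last first.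
  by rewrite big_const_seq count_predT iter_addr_0 [leRHS]mulr_natl.
rewrite big_seq [leRHS]big_seq; apply: ler_sum => a sa.
have M0 : 0 <= M by apply: le_trans (fM a sa); apply: Rintegral_ge0 => w _; exact: sqr_ge0.
under eq_Rintegral do rewrite mulrC.
rewrite Rintegral_sum_mul; [|by move=> b sb _; exact: fL|exact: fL].
rewrite (bigID (fun b => key b == key a))/= [X in _ + X]big_seq_cond [X in _ + X]big1 ?addr0; last first.
  by move=> b /andP[sb nk]; exact: orth.
apply: (@le_trans _ _ (\sum_(b <- s | key b == key a) M)).
  rewrite big_seq_cond [leRHS]big_seq_cond; apply: ler_sum => b /andP[sb _].
  have [aL bL] := (fL a sa, fL b sb).
  have : 0 <= \int[P]_w ((f b w - f a w) ^+ 2).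
    by apply: Rintegral_ge0 => w _; exact: sqr_ge0.
  by rewrite Rintegral_sqrB//; have := fM a sa; have := fM b sb; lra.
rewrite big_const_seq iter_addr_0 -[leLHS]mulr_natl ler_wpM2r// ler_nat.
by apply: leq_trans (cL a sa).
Qed.

End orthogonal_sum.

(** * The projections on graphs with many vertices *)

Lemma sum_nat_count (I : Type) (s : seq I) (a : pred I) :
  (\sum_(x <- s) a x)%N = count a s.
Proof. by elim: s => [|x s IH]; rewrite ?big_nil// big_cons IH. Qed.

Section remainder.
Context {d : measure_display} {T : measurableType d} {R : realType}.
Variables (P : probability T R) (H : noise_index -> T -> R).
Hypothesis mH : forall k, measurable_fun setT (H k).
Hypothesis indep : mutually_independent P H.
Variables (p q g : nat) (X : {fset nat} -> {fset nat} -> T -> R) (M : R).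
Hypothesis XL : forall i j, #|` i| = p -> #|` j| = q -> X i j \in Lfun P 2%:E.
Hypothesis XM : forall i j, #|` i| = p -> #|` j| = q -> \int[P]_w (X i j w ^+ 2) <= M.
Hypothesis gE : forall i j, #|` i| = p -> #|` j| = q ->
  size (subgraphs (complete_graph i j)) = g.

Definition high_order_sum dg m n w :=
  \sum_(i <- ksubsets p (seg m)) \sum_(j <- ksubsets q (seg n))
    \sum_(G <- subgraphs (complete_graph i j) | (dg < v1 G + v2 G)%N)
      graph_proj P H (X i j) G w.

Lemma subgraph_complete G i j : subgraph G (complete_graph i j) =
  (V1 G `<=` i)%fset && (V2 G `<=` j)%fset.
Proof.
rewrite /subgraph /=; case: (boolP (V1 G `<=` i)%fset) => //= /fsubsetP a.
case: (boolP (V2 G `<=` j)%fset) => //= /fsubsetP b.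
apply/fsubsetP => e /(fsubsetP (valP G)); rewrite /edges /= !inE.
by move=> /andP[/a -> /b ->].
Qed.

Section indices.
Variables (dg m n : nat).

Definition pairs := [seq (i, j) | i <- ksubsets p (seg m), j <- ksubsets q (seg n)].

Definition high_graphs (ij : {fset nat} * {fset nat}) :=
  [seq G <- subgraphs (complete_graph ij.1 ij.2) | (dg < v1 G + v2 G)%N].

Definition triples := [seq (ij, G) | ij <- pairs, G <- high_graphs ij].

Lemma mem_pairs ij : ij \in pairs -> #|` ij.1| = p /\ #|` ij.2| = q.
Proof.
move=> /allpairsP[[i j] /= [iA jB ->]] /=.
by move: iA jB; rewrite !mem_ksubsets => /andP[_ /eqP ->] /andP[_ /eqP ->].
Qed.

Lemma mem_triples t : t \in triples -> [/\ #|` t.1.1| = p, #|` t.1.2| = q,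
  subgraph t.2 (complete_graph t.1.1 t.1.2) & (dg < v1 t.2 + v2 t.2)%N].
Proof.
move=> /allpairsPdep[ij [G [/mem_pairs[ip jq] + ->]]] /=.
by rewrite mem_filter mem_subgraphs => /andP[].
Qed.

Lemma high_order_sumE w : high_order_sum dg m n w =
  \sum_(t <- triples) graph_proj P H (X t.1.1 t.1.2) t.2 w.
Proof.
rewrite /triples big_allpairs_dep /pairs big_allpairs_dep /=.
by apply: eq_bigr => i _; apply: eq_bigr => j _; rewrite big_filter.
Qed.

Lemma size_triples : (size triples <= 'C(m, p) * 'C(n, q) * g)%N.
Proof.
rewrite size_allpairs_dep sumnE big_map.
apply: (@leq_trans (\sum_(ij <- pairs) g)%N).
  rewrite big_seq [leqRHS]big_seq; apply: leq_sum => ij /mem_pairs[ip jq].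
  by rewrite size_filter (leq_trans (count_size _ _))// gE.
rewrite big_const_seq count_predT iter_addn_0 mulnC leq_mul2r.
by rewrite size_allpairs !size_ksubsets leqnn orbT.
Qed.

(** A graph with r row and c column vertices extends to a pair of index sets in at
    most m^(p - r) n^(q - c) ways, and here r + c > dg. *)
Lemma count_triples t : (0 < m + n)%N -> t \in triples ->
  (count (fun t' => t'.2 == t.2) triples <= (m + n) ^ (p + q - dg.+1))%N.
Proof.
move=> mn0 /mem_triples[ip jq]; set G := t.2.
rewrite subgraph_complete => /andP[Gi Gj] dG.
have [rp cq] : (v1 G <= p)%N /\ (v2 G <= q)%N.
  by rewrite -ip -jq; split; exact: fsubset_leq_card.
rewrite -sum1_count big_mkcond /triples big_allpairs_dep /pairs big_allpairs_dep /=.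
apply: (@leq_trans (\sum_(i <- ksubsets p (seg m)) \sum_(j <- ksubsets q (seg n))
    (V1 G `<=` i)%fset * (V2 G `<=` j)%fset)%N).
  apply: leq_sum => i _; apply: leq_sum => j _.
  rewrite -big_mkcond sum1_count mulnb -subgraph_complete -mem_subgraphs.
  rewrite (count_uniq_mem _ (filter_uniq _ (fset_uniq _))) mem_filter.
  by case: (_ < _)%N; rewrite ?leq0n.
rewrite -big_distrlr /= !sum_nat_count.
apply: leq_trans (leq_mul (count_superset _ _) (count_superset _ _)) _ => //.
apply: (@leq_trans ((m + n) ^ (p - v1 G) * (m + n) ^ (q - v2 G))%N).
  apply: leq_mul.
    by case: (p - v1 G)%N => [|k]; rewrite ?expn0// leq_exp2r// leq_addr.
  by case: (q - v2 G)%N => [|k]; rewrite ?expn0// leq_exp2r// leq_addl.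
rewrite -expnD; rewrite leq_pexp2l//.
by rewrite -/(v1 G) -/(v2 G); lia.
Qed.

End indices.

Lemma high_order_sum_Lfun2 dg m n : (fun w => high_order_sum dg m n w) \in Lfun P 2%:E.
Proof.
under eq_fun do rewrite high_order_sumE.
apply: Lfun2_sum => t /mem_triples[ip jq _ _] _.
by apply: proj_Lfun2 => //; exact: XL.
Qed.

(** Only triples with the same graph contribute to the second moment. The factor
    [m + n] on the left stands for a division of the right-hand side; an exponent
    [p + q - dg.+1] there would be wrong for [dg = p + q], where the truncated
    subtraction gives 0 instead of -1. *)
Lemma high_order_sum_bound dg m n : (0 < m + n)%N -> 0 <= M ->
  (m + n)%:R * \int[P]_w (high_order_sum dg m n w ^+ 2) <=
  ('C(m, p) * 'C(n, q) * g)%:R * ((m + n) ^ (p + q - dg))%:R * M.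
Proof.
move=> mn0 M0; under eq_Rintegral do rewrite high_order_sumE.
have [->|s0] := eqVneq (triples dg m n) [::].
  under eq_Rintegral do rewrite big_nil expr0n.
  by rewrite Rintegral_cst// mul0r mulr0 !mulr_ge0.
have [t st] : exists t, t \in triples dg m n.
  by case: triples s0 => // t s _; exists t; rewrite inE eqxx.
have dpq : (dg < p + q)%N.
  have [ip jq Gij dG] := mem_triples st; apply: leq_trans dG _.
  move: Gij; rewrite subgraph_complete => /andP[Gi Gj].
  by rewrite -ip -jq; apply: leq_add; exact: fsubset_leq_card.
pose f t := graph_proj P H (X t.1.1 t.1.2) t.2.
have f1 a : a \in triples dg m n -> f a \in Lfun P 2%:E.
  by move=> /mem_triples[ip jq _ _]; apply: proj_Lfun2 => //; exact: XL.
have f2 a : a \in triples dg m n -> \int[P]_w (f a w ^+ 2) <= M.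
  move=> /mem_triples[ip jq _ _]; apply: le_trans (XM ip jq).
  by apply: proj_sqr_le => //; exact: XL.
have f3 a b : a \in triples dg m n -> b \in triples dg m n -> a.2 != b.2 ->
    \int[P]_w (f a w * f b w) = 0.
  move=> /mem_triples[ip jq _ _] /mem_triples[ip' jq' _ _] ab.
  by apply: proj_orthogonal => //; exact: XL.
have := Rintegral_sqr_sum_le f1 f2 f3 (fun a => count_triples mn0).
rewrite -(ler_pM2l (_ : 0 < (m + n)%:R)) ?ltr0n// => /le_trans; apply.
rewrite -(subnSK dpq) expnS !mulrA ler_wpM2r// -!natrM ler_nat.
by rewrite [(_ * size _)%N]mulnC -mulnA leq_mul2r size_triples orbT.
Qed.

End remainder.

(** * Almost sure Hoeffding decomposition of the statistic *)

Section decomposition.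
Context {R : realType} {disp : measure_display} {T : measurableType disp}.
Variables (P : probability T R) (Y : nat -> nat -> {RV P >-> R}).
Variables (xi eta : nat -> {RV P >-> R}) (zeta : nat -> nat -> {RV P >-> R}).
Hypothesis xi_unif : forall i, uniform01 (xi i).
Hypothesis eta_unif : forall j, uniform01 (eta j).
Hypothesis zeta_unif : forall i j, uniform01 (zeta i j).
Local Notation H := (noise xi eta zeta).
Hypothesis noise_indep : mutually_independent P H.
Variable phi : R * R * R -> R.
Hypothesis phi_meas : measurable_fun
  (`[0%R, 1%R] `*` `[0%R, 1%R] `*` `[0%R, 1%R] : set (R * R * R)) phi.
Hypothesis Y_repr : forall i j,
  \forall w \ae P, Y i j w = phi (xi i w, eta j w, zeta i j w).
Variables (p q : nat) (h : 'M[R]_(p, q) -> R).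
Hypothesis h_meas : forall B : set R, measurable B ->
  sigma_gen setT (fun (k : 'I_p * 'I_q) (M : 'M[R]_(p, q)) => M k.1 k.2) (h @^-1` B).
Hypothesis h_L2 : forall i j : {fset nat}, #|` i| = p -> #|` j| = q ->
  ('E_P[fun w => (hval h Y i j w ^+ 2)%R] < +oo)%E.
Variable dg : nat.
Hypothesis dg_principal : is_principal_degree h Y H dg.

Local Notation proj := (graph_proj P H).
Local Notation mean := (graph_proj P H (hval h Y (seg p) (seg q)) empty_graph).
Let mH := measurable_noise xi eta zeta.
Let hL i j (ip : #|` i| = p) (jq : #|` j| = q) := hval_Lfun2 h_meas h_L2 ip jq.

(** If [G] has k vertices, then E[p^(k) p^G] = E[(p^G)^2] by orthogonality. *)
Lemma proj_low_order G : subgraph G (complete_graph (seg p) (seg q)) ->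
  (0 < v1 G + v2 G < dg)%N -> \forall w \ae P, proj (hval h Y (seg p) (seg q)) G w = 0.
Proof.
move=> GK Gd; have XL := hL (card_seg p) (card_seg q).
have [_ _ /(_ _ Gd) level0] := dg_principal.
have pL F : proj (hval h Y (seg p) (seg q)) F \in Lfun P 2%:E by exact: proj_Lfun2.
apply: (Rintegral_sqr_eq0 (pL G)).
transitivity (\int[P]_w (proj_level h Y H (v1 G + v2 G) w *
    proj (hval h Y (seg p) (seg q)) G w)).
  rewrite /proj_level Rintegral_sum_mul//.
  rewrite big_mkcond (bigD1_seq G) ?fset_uniq ?mem_subgraphs//= eqxx big1 ?addr0.
    by apply: eq_Rintegral => w _; rewrite expr2.
  by move=> F nFG; case: ifP => // _; exact: proj_orthogonal.
have lL : proj_level h Y H (v1 G + v2 G) \in Lfun P 2%:E by exact: Lfun2_sum.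
rewrite (ae_Rintegral (Y := cst 0))//.
- by rewrite Rintegral_cst// mul0r.
- by apply: measurable_funM; [exact: Lfun2_measurable lL|exact: Lfun2_measurable (pL G)].
- by apply: filterS level0 => w ->; rewrite mul0r.
Qed.

Lemma hval_moment_seg i j k : (0 < k <= 2)%N -> #|` i| = p -> #|` j| = q ->
  \int[P]_w (hval h Y i j w ^+ k) = \int[P]_w (hval h Y (seg p) (seg q) w ^+ k).
Proof.
move=> k12 ip jq; have [mu muE] := noise_law_exists xi eta zeta.
have mom := hval_moment xi_unif eta_unif zeta_unif noise_indep phi_meas Y_repr h_meas h_L2 muE k12.
by rewrite (mom _ _ ip jq) (mom _ _ (card_seg p) (card_seg q)).
Qed.

Lemma proj_empty i j : #|` i| = p -> #|` j| = q ->
  proj (hval h Y i j) empty_graph = mean.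
Proof.
move=> ip jq; rewrite !graph_proj_empty; congr (cst _).
have := @hval_moment_seg i j 1 isT ip jq.
by rewrite /Rintegral unlock; under eq_integral do rewrite expr1;
  under [in RHS]eq_integral do rewrite expr1.
Qed.

Lemma v12_empty : (v1 empty_graph + v2 empty_graph)%N = 0%N.
Proof. exact: f_equal2 (cardfs0 _) (cardfs0 _). Qed.

Lemma v12_eq0 F : (v1 F + v2 F = 0)%N -> F = empty_graph.
Proof.
move=> /eqP; rewrite addn_eq0 !cardfs_eq0 => /andP[/eqP a /eqP b].
apply: bigraphP => //; apply/fsetP => e; apply/negP => eF.
have /andP[eV _] : (e.1 \in V1 F) && (e.2 \in V2 F).
  by rewrite -in_fsetM; exact: (fsubsetP (valP F)).
by move: eV; rewrite a inE.
Qed.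

(** Of the projections with fewer than [dg] vertices only the one on the empty
    graph is left, and it is the mean. *)
Lemma hval_decomposition i j : #|` i| = p -> #|` j| = q ->
  \forall w \ae P, hval h Y i j w - mean w -
    \sum_(G <- subgraphs (complete_graph i j) | (v1 G + v2 G)%N == dg) proj (hval h Y i j) G w =
    \sum_(G <- subgraphs (complete_graph i j) | (dg < v1 G + v2 G)%N) proj (hval h Y i j) G w.
Proof.
move=> ip jq; have [d0 _ _] := dg_principal.
have sumE := hval_sum_proj xi_unif eta_unif zeta_unif noise_indep phi_meas Y_repr h_meas h_L2 ip jq.
have low : \forall w \ae P, \sum_(G <- subgraphs (complete_graph i j) |
    (0 < v1 G + v2 G < dg)%N) proj (hval h Y i j) G w = 0.
  have : \forall w \ae P, \sum_(G <- subgraphs (complete_graph i j) |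
      (0 < v1 G + v2 G < dg)%N) proj (hval h Y i j) G w =
      \sum_(G <- subgraphs (complete_graph i j) | (0 < v1 G + v2 G < dg)%N) 0.
    apply: ae_sum => F; rewrite mem_subgraphs => FK Fd.
    have [mu muE] := noise_law_exists xi eta zeta.
    apply: (proj_null xi_unif eta_unif zeta_unif noise_indep phi_meas Y_repr h_meas h_L2 muE ip jq FK).
    by move=> G GK e1 e2; apply: proj_low_order; rewrite // e1 e2.
  by apply: filterS => w ->; rewrite big1.
apply: filterS2 sumE low => w -> low; rewrite /proj_sum.
rewrite (bigD1_seq empty_graph) ?fset_uniq ?mem_subgraphs//=; last first.
  by rewrite /subgraph !fsub0set.
rewrite (proj_empty ip jq) [mean w + _]addrC addrK.
rewrite (bigID (fun G => (v1 G + v2 G)%N == dg))/= addrAC.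
rewrite (eq_bigl (fun G => (v1 G + v2 G)%N == dg)); last first.
  move=> F; apply: andb_idl => /eqP Fd; apply/eqP => F0.
  by move: Fd; rewrite F0 v12_empty; lia.
rewrite subrr add0r (bigID (fun G => (dg < v1 G + v2 G)%N))/=.
rewrite [X in _ + X](eq_bigl (fun G => (0 < v1 G + v2 G < dg)%N)) ?low ?addr0.
  apply: eq_bigl => F; apply/idP/idP => [/andP[]//|Fd].
  rewrite Fd gtn_eqF// !andbT; apply/eqP => F0.
  by move: Fd; rewrite F0 v12_empty; lia.
move=> F; have [->|F0] := eqVneq F empty_graph; first by rewrite v12_empty.
have : (v1 F + v2 F != 0)%N by apply: contra F0 => /eqP/v12_eq0 ->.
by lia.
Qed.

Lemma ustat_part_sum m n w :
  \sum_(r < p.+1) \sum_(c < q.+1 | ((r : nat, c : nat) != (0, 0)%N) && (r + c == dg)%N)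
    ustat_part h Y H r c m n w =
  'C(m, p)%:R^-1 * 'C(n, q)%:R^-1 *
  \sum_(i <- ksubsets p (seg m)) \sum_(j <- ksubsets q (seg n))
    \sum_(G <- subgraphs (complete_graph i j) | (v1 G + v2 G)%N == dg)
      proj (hval h Y i j) G w.
Proof.
have [d0 _ _] := dg_principal.
under eq_bigr do rewrite /ustat_part -mulr_sumr.
rewrite -mulr_sumr; congr (_ * _).
under eq_bigr do rewrite exchange_big /=.
rewrite exchange_big /= big_seq [RHS]big_seq; apply: eq_bigr => i iA.
under eq_bigr do rewrite exchange_big /=.
rewrite exchange_big /= big_seq [RHS]big_seq; apply: eq_bigr => j jB.
rewrite pair_big_dep /=.
have [ip jq] : #|` i| = p /\ #|` j| = q.
  by move: iA jB; rewrite !mem_ksubsets => /andP[_ /eqP ->] /andP[_ /eqP ->].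
(* the graphs with [dg] vertices, sorted by their numbers of row and column vertices *)
pose key (G : bigraph) : 'I_p.+1 * 'I_q.+1 := (inord (v1 G), inord (v2 G)).
have le_pq G : G \in subgraphs (complete_graph i j) -> (v1 G < p.+1)%N /\ (v2 G < q.+1)%N.
  rewrite mem_subgraphs subgraph_complete => /andP[Gi Gj].
  by rewrite !ltnS -ip -jq; split; exact: fsubset_leq_card.
rewrite [RHS]big_seq_cond (partition_big key (fun rc : 'I_p.+1 * 'I_q.+1 =>
  ((rc.1 : nat, rc.2 : nat) != (0, 0)%N) && (rc.1 + rc.2 == dg)%N)); last first.
  move=> G /andP[/le_pq[vp vq] /eqP Gd]; rewrite /key /= !inordK// Gd eqxx andbT.
  by apply/eqP => -[e1 e2]; move: d0; rewrite -Gd e1 e2.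
apply: eq_bigr => -[r c] /= /andP[_ /eqP rc].
rewrite big_seq_cond; apply: eq_bigl => G.
case: (boolP (G \in _)) => //= /le_pq[vp vq].
apply/eqP/andP => [[e1 e2]|[_ /eqP[<- <-]]]; last by rewrite !inordK.
by rewrite e1 e2 rc eqxx; split => //; apply/eqP; congr (_, _);
  apply: val_inj; rewrite /= inordK.
Qed.

Lemma card_ksubsets k m i : i \in ksubsets k (seg m) -> #|` i| = k.
Proof. by rewrite mem_ksubsets => /andP[_ /eqP]. Qed.

Lemma ustat_decomposition m n : (p <= m)%N -> (q <= n)%N ->
  \forall w \ae P, ustat h Y m n w - mean w -
    \sum_(r < p.+1) \sum_(c < q.+1 | ((r : nat, c : nat) != (0, 0)%N) && (r + c == dg)%N)
      ustat_part h Y H r c m n w =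
    'C(m, p)%:R^-1 * 'C(n, q)%:R^-1 * high_order_sum P H p q (hval h Y) dg m n w.
Proof.
move=> pm qn.
have : \forall w \ae P, \sum_(i <- ksubsets p (seg m)) \sum_(j <- ksubsets q (seg n))
    (hval h Y i j w - mean w - \sum_(G <- subgraphs (complete_graph i j) |
       (v1 G + v2 G)%N == dg) proj (hval h Y i j) G w) =
    high_order_sum P H p q (hval h Y) dg m n w.
  apply: ae_sum => i /card_ksubsets ip _; apply: ae_sum => j /card_ksubsets jq _.
  exact: hval_decomposition.
apply: filterS => w <-; rewrite ustat_part_sum /ustat.
set A := \sum_(i <- _) \sum_(j <- _) hval h Y i j w.
set B := \sum_(i <- _) \sum_(j <- _) \sum_(G <- _ | _) _.
have -> : \sum_(i <- ksubsets p (seg m)) \sum_(j <- ksubsets q (seg n))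
    (hval h Y i j w - mean w - \sum_(G <- subgraphs (complete_graph i j) |
       (v1 G + v2 G)%N == dg) proj (hval h Y i j) G w) =
    A - 'C(m, p)%:R * ('C(n, q)%:R * mean w) - B.
  under eq_bigr do rewrite !sumrB; rewrite !sumrB; congr (_ - _ - _).
  under eq_bigr do rewrite big_const_seq count_predT iter_addr_0 size_ksubsets.
  by rewrite big_const_seq count_predT iter_addr_0 size_ksubsets !mulr_natl.
by field; rewrite !pnatr_eq0 -!lt0n !bin_gt0 pm qn.
Qed.

(** * Size of the remainder *)

Variables (m n : nat -> nat) (rho : R).
Hypothesis mn_sum : forall N, (m N + n N)%N = N.
Hypothesis rho_gt0 : 0 < rho.
Hypothesis rho_lt1 : rho < 1.
Hypothesis m_lim : (m N)%:R / N%:R @[N --> \oo] --> rho.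

Lemma sample_sizes : exists2 a : R, 0 < a & \forall N \near \oo,
  [/\ (0 < N)%N, (2 * p <= m N)%N, (2 * q <= n N)%N,
      a * N%:R <= (m N)%:R & a * N%:R <= (n N)%:R].
Proof.
(* half of the smaller limiting proportion *)
pose a : R := Num.min rho (1 - rho) / 2.
have a0 : 0 < a by rewrite divr_gt0// lt_min rho_gt0 subr_gt0.
have [ar ar'] : 2 * a <= rho /\ 2 * a <= 1 - rho.
  by rewrite mulrC divfK// !ge_min !lexx orbT.
exists a => //; near=> N.
have N0 : (0 < N)%N by near: N; exact: nbhs_infty_gt.
have N0' : 0 < N%:R :> R by rewrite ltr0n.
have : `|rho - (m N)%:R / N%:R| <= a.
  by near: N; move/cvgrPdist_le: m_lim; apply.
rewrite ler_distlC => /andP[lo hi].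
have mE : (m N)%:R = (m N)%:R / N%:R * N%:R :> R by rewrite divfK// gt_eqF.
have nE : (n N)%:R = N%:R - (m N)%:R :> R by apply/eqP; rewrite eq_sym subr_eq -natrD addnC mn_sum.
have am : a * N%:R <= (m N)%:R by rewrite mE ler_wpM2r//; lra.
have an : a * N%:R <= (n N)%:R.
  by rewrite nE mE -[X in X - _]mul1r -mulrBl ler_wpM2r//; lra.
have big : (2 * (p + q))%:R <= a * N%:R.
  by rewrite mulrC -ler_pdivrMr//; near: N; exact: nbhs_infty_ger.
split => //.
- rewrite -(ler_nat R); apply: le_trans am; apply: le_trans big.
  by rewrite ler_nat leq_mul2l leq_addr orbT.
- rewrite -(ler_nat R); apply: le_trans an; apply: le_trans big.
  by rewrite ler_nat leq_mul2l leq_addl orbT.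
Unshelve. all: by end_near. Qed.

Lemma prod_bin_ge (a : R) N : 0 <= a -> (2 * p <= m N)%N -> (2 * q <= n N)%N ->
  a * N%:R <= (m N)%:R -> a * N%:R <= (n N)%:R ->
  a ^+ (p + q) * N%:R ^+ (p + q) <=
    (2 ^ p * p`! * (2 ^ q * q`!))%:R * ('C(m N, p)%:R * 'C(n N, q)%:R).
Proof.
move=> a0 pm qn am an; rewrite -exprMn exprD.
have aN : 0 <= a * N%:R by rewrite mulr_ge0.
apply: (@le_trans _ _ ((m N)%:R ^+ p * (n N)%:R ^+ q)).
  by apply: ler_pM; rewrite ?exprn_ge0// lerXn2r// nnegrE.
rewrite -!natrX -!natrM ler_nat.
have := leq_mul (bin_ge_exp pm) (bin_ge_exp qn).
by rewrite [(_ * _ * (_ * _ * _))%N]mulnACA.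
Qed.

Local Notation U N := (fun w => N%:R `^ (dg%:R / 2) * (ustat h Y (m N) (n N) w - mean w)).
Local Notation V N := (fun w => N%:R `^ (dg%:R / 2) *
  \sum_(r < p.+1) \sum_(c < q.+1 | ((r : nat, c : nat) != (0, 0)%N) && (r + c == dg)%N)
    ustat_part h Y H r c (m N) (n N) w).

Lemma statistic_Lfun2 N : U N \in Lfun P 2%:E.
Proof.
apply: Lfun2Z; apply: Lfun2B; last first.
  by apply: proj_Lfun2 => //; apply: hL; exact: card_seg.
apply: Lfun2Z; apply: Lfun2_sum => i /card_ksubsets ip _.
by apply: Lfun2_sum => j /card_ksubsets jq _; exact: hL.
Qed.

Lemma leading_part_Lfun2 N : V N \in Lfun P 2%:E.
Proof.
apply: Lfun2Z; under eq_fun do rewrite ustat_part_sum; apply: Lfun2Z.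
apply: Lfun2_sum => i /card_ksubsets ip _.
apply: Lfun2_sum => j /card_ksubsets jq _.
by apply: Lfun2_sum => G _ _; apply: proj_Lfun2 => //; exact: hL.
Qed.

(** The difference is N^(d/2) times the high order sum divided by the two binomial
    coefficients. The second moment of the sum is of order N^(p + q - d - 1) times
    the product of these coefficients, which is itself of order N^(p + q); this
    leaves k / N. *)
Lemma remainder_cvg0 :
  \int[P]_w ((U N w - V N w) ^+ 2) @[N --> \oo] --> 0.
Proof.
have [d0 _ _] := dg_principal.
have [a a0 sizes] := sample_sizes.
pose M := \int[P]_w (hval h Y (seg p) (seg q) w ^+ 2).
pose g := size (subgraphs (complete_graph (seg p) (seg q))).
have gE i j : #|` i| = p -> #|` j| = q -> size (subgraphs (complete_graph i j)) = g.
  move=> ip jq; rewrite -(relabel_label_complete ip jq).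
  rewrite (perm_size (subgraphs_relabel (@label_inj i) (@label_inj j) _)).
  by rewrite size_map.
have M0 : 0 <= M by apply: Rintegral_ge0 => w _; exact: sqr_ge0.
have XM i j : #|` i| = p -> #|` j| = q -> \int[P]_w (hval h Y i j w ^+ 2) <= M.
  by move=> ip jq; rewrite (hval_moment_seg _ ip jq).
pose k : R := g%:R * M * ((2 ^ p * p`! * (2 ^ q * q`!))%:R / a ^+ (p + q)).
have bound : \forall N \near \oo, \int[P]_w ((U N w - V N w) ^+ 2) <= k / N%:R.
  apply: filterS sizes => N [N0 pm qn am an].
  have N0' : 0 < N%:R :> R by rewrite ltr0n.
  have pm' : (p <= m N)%N by apply: leq_trans pm; exact: leq_pmull.
  have qn' : (q <= n N)%N by apply: leq_trans qn; exact: leq_pmull.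
  set C : R := 'C(m N, p)%:R * 'C(n N, q)%:R.
  have C0 : 0 < C by rewrite mulr_gt0// ltr0n bin_gt0.

  set S := high_order_sum P H p q (hval h Y) dg (m N) (n N).
  have SL : S \in Lfun P 2%:E by exact: high_order_sum_Lfun2.
  have UV : \forall w \ae P, (U N w - V N w) ^+ 2 = N%:R ^+ dg * C ^- 2 * S w ^+ 2.

    apply: filterS (ustat_decomposition pm' qn') => w e.
    rewrite -mulrBr e -invfM -/C -/S exprMn [(_ * S w) ^+ 2]exprMn exprVn mulrA.
    congr (_ * _ * _).
    by rewrite -powR_mulrn ?powR_ge0// -powRrM divfK// powR_mulrn.
  have S2 : (fun w => S w ^+ 2) \in Lfun P 1.
    by apply/Lfun1_integrable; exact: Lfun2_integrable_sqr.
  rewrite (ae_Rintegral (Y := fun w => N%:R ^+ dg * C ^- 2 * S w ^+ 2) _ _ _ UV)//; last 2 first.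
  - apply: measurable_funX.
    exact: Lfun2_measurable (Lfun2B (statistic_Lfun2 N) (leading_part_Lfun2 N)).
  - by apply: measurable_funM => //; exact: Lfun1_measurable S2.
  rewrite RintegralZl//; last exact/Lfun1_integrable.
  rewrite ler_pdivlMr//.
  have mnN : (0 < m N + n N)%N by rewrite mn_sum.
  have := high_order_sum_bound mH noise_indep hL XM gE dg mnN M0.
  rewrite mn_sum -/S => Sb.
  have Cb := prod_bin_ge (ltW a0) pm qn am an.
  rewrite -/C in Cb.
  have dE : N%:R ^+ dg * N%:R ^+ (p + q - dg) = N%:R ^+ (p + q) :> R.
    by rewrite -exprD subnKC//; case/andP: d0.
  apply: (@le_trans _ _ (N%:R ^+ dg * C ^- 2 * (C * g%:R * N%:R ^+ (p + q - dg) * M))).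
    rewrite -[leLHS]mulrA ler_wpM2l//; first by rewrite mulr_ge0 ?exprn_ge0 ?invr_ge0 ?exprn_ge0// ltW.
    by rewrite mulrC; move: Sb; rewrite !natrM natrX.
  have -> : N%:R ^+ dg * C ^- 2 * (C * g%:R * N%:R ^+ (p + q - dg) * M) =
      g%:R * M * (N%:R ^+ (p + q) / C).
    by rewrite -dE; field; rewrite gt_eqF.
  rewrite /k ler_wpM2l ?mulr_ge0// ler_pdivrMr// mulrAC ler_pdivlMr ?exprn_gt0//.
  by rewrite mulrC.
apply/cvgrPdist_le => e e0.
near=> N; rewrite sub0r normrN ger0_norm; last first.
  by apply: Rintegral_ge0 => w _; exact: sqr_ge0.
apply: (@le_trans _ _ (k / N%:R)); first by near: N.
have N0 : 0 < N%:R :> R by rewrite ltr0n; near: N; exact: nbhs_infty_gt.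
rewrite ler_pdivrMr// mulrC -ler_pdivrMr//.
by near: N; exact: nbhs_infty_ger.
Unshelve. all: by end_near. Qed.

End decomposition.

Theorem theorem3p2 (R : realType)
  (disp : measure_display) (T : measurableType disp) (P : probability T R)
  (Y : nat -> nat -> {RV P >-> R})
  (Y_exch : row_column_exchangeable Y)
  (Y_diss : dissociated Y)
  (xi eta : nat -> {RV P >-> R}) (zeta : nat -> nat -> {RV P >-> R})
  (xi_unif : forall i, uniform01 (xi i))
  (eta_unif : forall j, uniform01 (eta j))
  (zeta_unif : forall i j, uniform01 (zeta i j))
  (noise_indep : mutually_independent P (noise xi eta zeta))
  (phi : R * R * R -> R)
  (phi_meas : measurable_fun (`[0%R, 1%R] `*` `[0%R, 1%R] `*` `[0%R, 1%R] : set (R * R * R)) phi)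
  (Y_repr : forall i j,
    \forall w \ae P, Y i j w = phi (xi i w, eta j w, zeta i j w))
  (p q : nat) (p_gt0 : (0 < p)%N) (q_gt0 : (0 < q)%N)
  (h : 'M[R]_(p, q) -> R)
  (h_meas : forall B : set R, measurable B ->
    sigma_gen setT (fun (k : 'I_p * 'I_q) (M : 'M[R]_(p, q)) => M k.1 k.2)
      (h @^-1` B))
  (h_sym : forall (s : 'S_p) (t : 'S_q) (M : 'M[R]_(p, q)),
    h (row_perm s (col_perm t M)) = h M)
  (h_L2 : forall i j : {fset nat}, #|` i| = p -> #|` j| = q ->
    ('E_P[fun w => (hval h Y i j w ^+ 2)%R] < +oo)%E)
  (m n : nat -> nat) (rho : R)
  (mn_sum : forall N, (m N + n N)%N = N)
  (rho_gt0 : 0 < rho) (rho_lt1 : rho < 1)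
  (m_lim : (m N)%:R / N%:R @[N --> \oo] --> rho)
  (dg : nat) (dg_principal : is_principal_degree h Y (noise xi eta zeta) dg)
  (disp' : measure_display) (T' : measurableType disp')
  (Q : probability T' R) (W : {RV Q >-> R}) :
  cvg_in_law P
    (fun N w => N%:R `^ (dg%:R / 2) *
       (ustat h Y (m N) (n N) w -
        graph_proj P (noise xi eta zeta) (hval h Y (seg p) (seg q)) empty_graph w))
    Q W <->
  cvg_in_law P
    (fun N w => N%:R `^ (dg%:R / 2) *
       \sum_(r < p.+1) \sum_(c < q.+1 |
           ((r : nat, c : nat) != (0, 0)%N) && (r + c == dg)%N)
         ustat_part h Y (noise xi eta zeta) r c (m N) (n N) w)
    Q W.
Proof.
have U2 := statistic_Lfun2 xi eta zeta h_meas h_L2 dg m n.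
have V2 := leading_part_Lfun2 h_meas h_L2 dg_principal m n.
have UV0 := remainder_cvg0 xi_unif eta_unif zeta_unif noise_indep phi_meas Y_repr
  h_meas h_L2 dg_principal mn_sum rho_gt0 rho_lt1 m_lim.
have mW : measurable_fun setT W by exact: measurable_funP.
split; apply: cvg_in_law_perturb => //; try by move=> N; exact: Lfun2_measurable.
- by apply: nearW => N; exact: Lfun2B.
- by under eq_fun do under eq_Rintegral do rewrite -sqrrN opprB.
- by apply: nearW => N; exact: Lfun2B.
Qed.
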